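(* Let $1<p<2$ and $c_p=\sec\frac{\pi}{2p}$. Let $\Omega\subseteq\mathbf{C}$ be a domain and $\zeta_0\in\Omega$. Assume that $U\in (Lh)^p(\Omega)$ is positive and that there exists a harmonic conjugate $V$ of $U$ on $\Omega$, normalized by $V(\zeta_0)=0$. Then $U+iV$ belongs to the analytic Lumer's Hardy space $(LH)^p(\Omega)$ and $$\|U+iV\|_{p,\zeta_0}\le c_p\,\|U\|_{p,\zeta_0}.$$ Moreover, the constant $c_p$ is best possible, i.e. it cannot be replaced by a smaller constant for which the inequality holds for all such $\Omega$, $\zeta_0$ and positive $U$.
   Context: For a domain $\Omega\subseteq\mathbf{C}$, the harmonic Lumer's Hardy space $(Lh)^p(\Omega)$ consists of all harmonic functions $U$ on $\Omega$ such that the subharmonic function $|U|^p$ has a harmonic majorant on $\Omega$; then $|U|^p$ has a least harmonic majorant, denoted $H_U$. The analytic Lumer's Hardy space $(LH)^p(\Omega)$ is the subspace of analytic functions in $(Lh)^p(\Omega)$ (complex-valued harmonic functions being allowed). For $\zeta_0\in\Omega$ the norm is $\|U\|_{p,\zeta_0}=H_U(\zeta_0)^{1/p}$. A harmonic conjugate of a real harmonic $U$ on $\Omega$ is a real harmonic function $V$ on $\Omega$ such that $U+iV$ is analytic. *)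

(* Defs.v *)
From Stdlib Require Import Reals ClassicalEpsilon.
From Coquelicot Require Import Coquelicot.

Open Scope R_scope.

Definition connected (D : C -> Prop) : Prop :=
  forall A B : C -> Prop,
    open A -> open B ->
    (forall z, D z -> A z \/ B z) ->
    (exists z, D z /\ A z) ->
    (exists z, D z /\ B z) ->
    exists z, D z /\ A z /\ B z.

Definition domain (D : C -> Prop) : Prop :=
  open D /\ connected D /\ (exists z, D z).

(* [Rpower 0 a] is [1] for every [a], since [ln 0 = 0] in Stdlib; here [0] is
   sent to [0].  Only used for nonnegative bases and positive exponents. *)
Definition rpow (x a : R) : R :=
  if Rle_dec x 0 then 0 else Rpower x a.

Definition dx (u : C -> R) (z : C) : R := Derive (fun t => u (t, Im z)) (Re z).
Definition dy (u : C -> R) (z : C) : R := Derive (fun t => u (Re z, t)) (Im z).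

Definition C1_on (D : C -> Prop) (u : C -> R) : Prop :=
  forall z, D z ->
    ex_derive (fun t => u (t, Im z)) (Re z) /\
    ex_derive (fun t => u (Re z, t)) (Im z) /\
    continuous (dx u) z /\ continuous (dy u) z.

Definition C2_on (D : C -> Prop) (u : C -> R) : Prop :=
  C1_on D u /\ C1_on D (dx u) /\ C1_on D (dy u).

Definition harmonic (D : C -> Prop) (u : C -> R) : Prop :=
  C2_on D u /\ forall z, D z -> dx (dx u) z + dy (dy u) z = 0.

Definition harmonicC (D : C -> Prop) (F : C -> C) : Prop :=
  harmonic D (fun z => Re (F z)) /\ harmonic D (fun z => Im (F z)).

Definition analytic (D : C -> Prop) (F : C -> C) : Prop :=
  forall z, D z -> @ex_derive C_AbsRing C_NormedModule F z.

Definition harmonic_majorant (D : C -> Prop) (u h : C -> R) : Prop :=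
  harmonic D h /\ forall z, D z -> u z <= h z.

Definition is_least_harmonic_majorant (D : C -> Prop) (u h : C -> R) : Prop :=
  harmonic_majorant D u h /\
  forall k, harmonic_majorant D u k -> forall z, D z -> h z <= k z.

(* Unique on [D] when it exists; arbitrary outside [D], and arbitrary
   everywhere when there is no least harmonic majorant. *)
Definition least_harmonic_majorant (D : C -> Prop) (u : C -> R) : C -> R :=
  epsilon (inhabits (fun _ : C => 0)) (is_least_harmonic_majorant D u).

Definition mod_pow (p : R) (F : C -> C) (z : C) : R := rpow (Cmod (F z)) p.

Definition Lh (p : R) (D : C -> Prop) (F : C -> C) : Prop :=
  harmonicC D F /\ exists h, harmonic_majorant D (mod_pow p F) h.

Definition LH (p : R) (D : C -> Prop) (F : C -> C) : Prop :=
  Lh p D F /\ analytic D F.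

Definition Lumer_norm (p : R) (D : C -> Prop) (z0 : C) (F : C -> C) : R :=
  rpow (least_harmonic_majorant D (mod_pow p F) z0) (1 / p).

Definition complexify (U : C -> R) (z : C) : C := RtoC (U z).
Definition with_conjugate (U V : C -> R) (z : C) : C :=
  (RtoC (U z) + Ci * RtoC (V z))%C.

Definition harmonic_conjugate (D : C -> Prop) (U V : C -> R) : Prop :=
  harmonic D V /\ analytic D (with_conjugate U V).

Definition admissible (p : R) (D : C -> Prop) (z0 : C) (U V : C -> R) : Prop :=
  domain D /\ D z0 /\
  Lh p D (complexify U) /\ (forall z, D z -> 0 < U z) /\
  harmonic_conjugate D U V /\ V z0 = 0.

Definition sec (x : R) : R := / cos x.

(* Main.v *)
Require Import Defs.
From Stdlib Require Import Reals Lra Psatz FunctionalExtensionality ClassicalEpsilon Classical.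
From Coquelicot Require Import Coquelicot.
Open Scope R_scope.

(** Write [F = U + iV], [th = PI / (2 p)]. On the right half-plane
    [|F|^p <= sec(th)^p U^p - tan(th) Re(F^p)], because
    [(1 + tan(th) cos(p x)) / cos(x)^p] is maximal at [x = th]. Since [Re(F^p)] is harmonic and equals
    [U^p > 0] at the base point, a harmonic majorant [H] of [U^p] yields the majorant
    [sec(th)^p H - tan(th) Re(F^p)] of [|F|^p], which is at most [sec(th)^p H] at the base point.

    Comparing norms requires least harmonic majorants to exist on an arbitrary open set. They do for every
    function that is, at each point, touched from below by a harmonic minorant ([U^p] by tangent
    lines in [U], [|F|^p] by the functions [Re(e^(-i al) F^p)]): take the infimum of
    the continuous viscosity-superharmonic majorants; replacing such a majorant by its Poisson integral on a disc
    stays in the class, and Harnack's inequality makes the infimum a local uniform limit of harmonic functions.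

    Sharpness comes from [F(z) = e^z] on the strip [|Im z| < phi] with [phi < th]. The least harmonic
    majorant [h] of [|F|^p = e^(p x)] inherits the scaling [h(x + t, y) = e^(p t) h(x, y)], so it is
    [e^(p x) f(y)] with [f'' = - p^2 f] and [f >= 1], whence [f(0) cos(p phi) >= 1]; the corresponding
    value for [U^p] is at most [cos(phi)^p / cos(p phi)], so the ratio of norms is at least [sec(phi)]. *)

(** * Harmonic functions *)

(** The coefficient [tan(th)] is forced by the critical point: the derivative of
    [(1 + T cos(p x)) / cos(x)^p] has the sign of [sin x - T sin((p - 1) x)], and [p th = PI / 2]
    turns its vanishing at [th] into [sin th = T cos th]. There [cos(p th) = 0], so the maximum is
    exactly [sec(th)^p].

    [Lumer_norm] evaluates a function picked by [epsilon], which carries information only once a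
    least harmonic majorant is known to exist; one explicit majorant is not enough to compare norms.
    The domain has no regularity, so no boundary values are available and a Perron argument is used.
    Superharmonicity tested by touching functions passes to minima at once and involves no mean
    values. Harmonicity asks for continuous second partials, which a uniform limit does not visibly
    inherit; the limit is therefore identified with its own Poisson integral by the maximum
    principle.

    The strips stay strictly inside [th] because [cos(phi)^p / cos(p phi)] blows up at [phi = th];
    letting [phi] tend to [th] recovers [sec(th)]. *)

Definition has_partials (u ux uy : C -> R) (z : C) : Prop :=
  is_derive (fun t => u (t, Im z)) (Re z) (ux z) /\
  is_derive (fun t => u (Re z, t)) (Im z) (uy z).

Lemma locally_C_iff (P : C -> Prop) (z : C) :
  locally z P <->
  exists d : posreal, forall x y,
    Rabs (x - Re z) < d -> Rabs (y - Im z) < d -> P (x, y).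
Proof.
  split; intros [d Hd]; exists d.
  - intros x y Hx Hy. apply Hd. split; assumption.
  - intros [x y] [Hx Hy]. apply Hd; assumption.
Qed.

Lemma locally_hor (P : C -> Prop) (z : C) :
  locally z P -> locally (Re z) (fun t => P (t, Im z)).
Proof.
  intros H. apply locally_C_iff in H. destruct H as [d Hd].
  exists d. intros t Ht. apply Hd; [exact Ht|].
  rewrite Rminus_diag, Rabs_R0. apply cond_pos.
Qed.

Lemma locally_ver (P : C -> Prop) (z : C) :
  locally z P -> locally (Im z) (fun t => P (Re z, t)).
Proof.
  intros H. apply locally_C_iff in H. destruct H as [d Hd].
  exists d. intros t Ht. apply Hd; [|exact Ht].
  rewrite Rminus_diag, Rabs_R0. apply cond_pos.
Qed.

Lemma has_partials_dx (u ux uy : C -> R) (z : C) : has_partials u ux uy z -> dx u z = ux z.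
Proof. intros [H _]. apply is_derive_unique, H. Qed.

Lemma has_partials_dy (u ux uy : C -> R) (z : C) : has_partials u ux uy z -> dy u z = uy z.
Proof. intros [_ H]. apply is_derive_unique, H. Qed.

Lemma C_eta (z : C) : z = (Re z, Im z).
Proof. destruct z; reflexivity. Qed.

Lemma has_partials_ext_loc (u v ux uy vx vy : C -> R) (z : C) :
  locally z (fun w => u w = v w) -> ux z = vx z -> uy z = vy z ->
  has_partials u ux uy z -> has_partials v vx vy z.
Proof.
  intros L Ex Ey [H1 H2]. split.
  - rewrite <- Ex. apply is_derive_ext_loc with (2 := H1). now apply locally_hor in L.
  - rewrite <- Ey. apply is_derive_ext_loc with (2 := H2). now apply locally_ver in L.
Qed.

Lemma C1_on_intro (D : C -> Prop) (u ux uy : C -> R) :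
  open D ->
  (forall z, D z -> has_partials u ux uy z) ->
  (forall z, D z -> continuous ux z) -> (forall z, D z -> continuous uy z) ->
  C1_on D u.
Proof.
  intros oD H cx cy z Dz. destruct (H z Dz) as [H1 H2].
  split; [eexists; exact H1|split; [eexists; exact H2|split]].
  - apply continuous_ext_loc with ux; [|now apply cx].
    apply (filter_imp D); [|now apply oD].
    intros w Dw. symmetry. now apply has_partials_dx with uy, H.
  - apply continuous_ext_loc with uy; [|now apply cy].
    apply (filter_imp D); [|now apply oD].
    intros w Dw. symmetry. now apply has_partials_dy with ux, H.
Qed.

(** [harmonic] speaks of iterated [Derive]s. Closed formulas can replace them because [D] is open:
    each formula then holds near every point of [D], so it may be differentiated again. *)
Lemma harmonic_intro (D : C -> Prop) (u ux uy uxx uxy uyx uyy : C -> R) :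
  open D ->
  (forall z, D z -> has_partials u ux uy z) ->
  (forall z, D z -> has_partials ux uxx uxy z) ->
  (forall z, D z -> has_partials uy uyx uyy z) ->
  (forall z, D z -> continuous ux z) -> (forall z, D z -> continuous uy z) ->
  (forall z, D z -> continuous uxx z) -> (forall z, D z -> continuous uxy z) ->
  (forall z, D z -> continuous uyx z) -> (forall z, D z -> continuous uyy z) ->
  (forall z, D z -> uxx z + uyy z = 0) ->
  harmonic D u.
Proof.
  intros oD H Hx Hy cx cy cxx cxy cyx cyy Lap.
  assert (Hx' : forall z, D z -> has_partials (dx u) uxx uxy z).
  { intros z Dz. apply has_partials_ext_loc with (4 := Hx z Dz); trivial.
    apply (filter_imp D); [|now apply oD].
    intros w Dw. symmetry. now apply has_partials_dx with uy, H. }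
  assert (Hy' : forall z, D z -> has_partials (dy u) uyx uyy z).
  { intros z Dz. apply has_partials_ext_loc with (4 := Hy z Dz); trivial.
    apply (filter_imp D); [|now apply oD].
    intros w Dw. symmetry. now apply has_partials_dy with ux, H. }
  split; [split; [|split]|].
  - exact (C1_on_intro D u ux uy oD H cx cy).
  - exact (C1_on_intro D (dx u) uxx uxy oD Hx' cxx cxy).
  - exact (C1_on_intro D (dy u) uyx uyy oD Hy' cyx cyy).
  - intros z Dz.
    rewrite (has_partials_dx _ _ _ _ (Hx' z Dz)), (has_partials_dy _ _ _ _ (Hy' z Dz)).
    now apply Lap.
Qed.

Lemma C1_on_partials (D : C -> Prop) (u : C -> R) (z : C) :
  C1_on D u -> D z -> has_partials u (dx u) (dy u) z.
Proof.
  intros H Dz. destruct (H z Dz) as (H1 & H2 & _).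
  split; now apply Derive_correct.
Qed.

Lemma C1_on_continuous_dx (D : C -> Prop) (u : C -> R) (z : C) :
  C1_on D u -> D z -> continuous (dx u) z.
Proof. intros H Dz. exact (proj1 (proj2 (proj2 (H z Dz)))). Qed.

Lemma C1_on_continuous_dy (D : C -> Prop) (u : C -> R) (z : C) :
  C1_on D u -> D z -> continuous (dy u) z.
Proof. intros H Dz. exact (proj2 (proj2 (proj2 (H z Dz)))). Qed.

(** Continuous partials give total differentiability. This is the source both of joint continuity
    and, later, of complex differentiability from the Cauchy-Riemann equations. *)
Lemma C1_on_filterdiff (D : C -> Prop) (u : C -> R) (z : C) :
  open D -> C1_on D u -> D z ->
  filterdiff (fun w : R * R => u (fst w, snd w)) (locally z)
    (fun w : R * R => plus (scal (fst w) (dx u z)) (scal (snd w) (dy u z))).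
Proof.
  intros oD H Dz.
  pose proof (is_derive_filterdiff (fun a b => u (a, b)) (Re z) (Im z) (fun a b => dx u (a, b)) (dy u z)) as F.
  cbn beta in F. rewrite <- C_eta in F. apply F.
  - apply (filter_imp D); [|now apply oD].
    intros w Dw. exact (proj1 (C1_on_partials D u w H Dw)).
  - exact (proj2 (C1_on_partials D u z H Dz)).
  - apply continuous_ext with (2 := C1_on_continuous_dx D u z H Dz). now intros [a b].
Qed.

Lemma C1_on_continuous (D : C -> Prop) (u : C -> R) (z : C) :
  open D -> C1_on D u -> D z -> continuous u z.
Proof.
  intros oD H Dz.
  assert (Hc : continuous (fun w : R * R => u (fst w, snd w)) z).
  { rewrite (C_eta z).
    refine (filterdiff_continuous (K := R_AbsRing)
      (U := prod_NormedModule R_AbsRing R_NormedModule R_NormedModule) (V := R_NormedModule) _ _ _).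
    eexists. rewrite <- C_eta. exact (C1_on_filterdiff D u z oD H Dz). }
  apply continuous_ext with (2 := Hc). now intros [a b].
Qed.

Lemma harmonic_continuous (D : C -> Prop) (u : C -> R) (z : C) :
  open D -> harmonic D u -> D z -> continuous u z.
Proof. intros oD [[H _] _]. now apply C1_on_continuous. Qed.

Lemma has_partials_lin (a b : R) (u v ux uy vx vy : C -> R) (z : C) :
  has_partials u ux uy z -> has_partials v vx vy z ->
  has_partials (fun w => a * u w + b * v w)
    (fun w => a * ux w + b * vx w) (fun w => a * uy w + b * vy w) z.
Proof.
  intros [H1 H2] [H3 H4]. split.
  - apply (is_derive_plus (fun t => a * u (t, Im z)) (fun t => b * v (t, Im z)));
      now apply is_derive_scal.
  - apply (is_derive_plus (fun t => a * u (Re z, t)) (fun t => b * v (Re z, t)));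
      now apply is_derive_scal.
Qed.

Lemma continuous_lin {T : UniformSpace} (a b : R) (u v : T -> R) (z : T) :
  continuous u z -> continuous v z -> continuous (fun w => a * u w + b * v w) z.
Proof.
  intros H1 H2.
  apply (continuous_plus (V := R_NormedModule) (fun w => a * u w) (fun w => b * v w));
    now apply (continuous_scal_r (V := R_NormedModule)).
Qed.

Lemma harmonic_lin (D : C -> Prop) (a b : R) (u v : C -> R) :
  open D -> harmonic D u -> harmonic D v -> harmonic D (fun w => a * u w + b * v w).
Proof.
  intros oD [(U & Ux & Uy) LU] [(V & Vx & Vy) LV].
  apply harmonic_intro with
   (ux := fun w => a * dx u w + b * dx v w) (uy := fun w => a * dy u w + b * dy v w)
   (uxx := fun w => a * dx (dx u) w + b * dx (dx v) w)
   (uxy := fun w => a * dy (dx u) w + b * dy (dx v) w)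
   (uyx := fun w => a * dx (dy u) w + b * dx (dy v) w)
   (uyy := fun w => a * dy (dy u) w + b * dy (dy v) w); trivial.
  1-3: intros z Dz; apply has_partials_lin; now apply C1_on_partials with D.
  7: { intros z Dz. specialize (LU z Dz). specialize (LV z Dz). nra. }
  1, 3, 5: intros z Dz; apply continuous_lin; apply C1_on_continuous_dx with D; assumption.
  all: intros z Dz; apply continuous_lin; apply C1_on_continuous_dy with D; assumption.
Qed.

Lemma harmonic_affine (D : C -> Prop) (a b c : R) :
  open D -> harmonic D (fun w => a + b * Re w + c * Im w).
Proof.
  intros oD.
  apply harmonic_intro with (ux := fun _ => b) (uy := fun _ => c)
    (uxx := fun _ => 0) (uxy := fun _ => 0) (uyx := fun _ => 0) (uyy := fun _ => 0); trivial.
  1-3: intros z _; split; cbn; auto_derive; trivial; ring.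
  1-6: intros; apply continuous_const.
  intros; ring.
Qed.

Lemma harmonic_subset (D E : C -> Prop) (u : C -> R) :
  (forall z, E z -> D z) -> harmonic D u -> harmonic E u.
Proof.
  intros HS [(U & Ux & Uy) LU].
  split; [split; [|split]|]; intros z Ez; auto.
Qed.

Lemma harmonic_ext (D : C -> Prop) (u v : C -> R) :
  open D -> (forall z, D z -> u z = v z) -> harmonic D u -> harmonic D v.
Proof.
  intros oD E [(U & Ux & Uy) LU].
  apply harmonic_intro with (ux := dx u) (uy := dy u) (uxx := dx (dx u)) (uxy := dy (dx u))
    (uyx := dx (dy u)) (uyy := dy (dy u)); trivial.
  { intros z Dz. apply has_partials_ext_loc with (4 := C1_on_partials _ _ _ U Dz); trivial.
    apply (filter_imp D); [exact E|now apply oD]. }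
  1, 2: intros z Dz; apply C1_on_partials with D; assumption.
  1, 3, 5: intros z Dz; apply C1_on_continuous_dx with D; assumption.
  all: intros z Dz; apply C1_on_continuous_dy with D; assumption.
Qed.

(** Every clause of [harmonic] is a statement at one point about a function defined on all of [C],
    so it can be read off from any [N] containing that point. *)
Lemma harmonic_local (D : C -> Prop) (u : C -> R) :
  (forall z, D z -> exists N : C -> Prop, N z /\ harmonic N u) -> harmonic D u.
Proof.
  intros H. split; [split; [|split]|]; intros z Dz; destruct (H z Dz) as (N & Nz & (A & B & E) & L); auto.
Qed.

(** * Superharmonic functions and the minimum principle *)

Definition sqd (c z : C) : R := (Re z - Re c) ^ 2 + (Im z - Im c) ^ 2.

Lemma sqd_pos c z : 0 <= sqd c z.
Proof. apply Rplus_le_le_0_compat; apply pow2_ge_0. Qed.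

Lemma sqd_le_box c z r : 0 < r -> sqd c z <= r ^ 2 ->
  - r <= Re z - Re c <= r /\ - r <= Im z - Im c <= r.
Proof.
  unfold sqd. intros Hr H. pose proof (pow2_ge_0 (Re z - Re c)). pose proof (pow2_ge_0 (Im z - Im c)).
  split; split; apply Rnot_lt_le; intros Hlt; nra.
Qed.

Lemma sqd_refl z : sqd z z = 0.
Proof. unfold sqd. ring. Qed.

Lemma continuous_Re (z : C) : continuous Re z.
Proof. apply (continuous_fst (U := R_UniformSpace) (V := R_UniformSpace)). Qed.

Lemma continuous_Im (z : C) : continuous Im z.
Proof. apply (continuous_snd (U := R_UniformSpace) (V := R_UniformSpace)). Qed.

Lemma continuous_Rmult {T : UniformSpace} (u v : T -> R) (z : T) :
  continuous u z -> continuous v z -> continuous (fun w => u w * v w) z.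
Proof. apply (continuous_mult (K := R_AbsRing)). Qed.

Lemma continuous_Rplus {T : UniformSpace} (u v : T -> R) (z : T) :
  continuous u z -> continuous v z -> continuous (fun w => u w + v w) z.
Proof. apply (continuous_plus (V := R_NormedModule)). Qed.

Lemma continuous_Rminus {T : UniformSpace} (u v : T -> R) (z : T) :
  continuous u z -> continuous v z -> continuous (fun w => u w - v w) z.
Proof. apply (continuous_minus (V := R_NormedModule)). Qed.

Lemma continuous_derivable {T : UniformSpace} (g : R -> R) (u : T -> R) (z : T) :
  ex_derive g (u z) -> continuous u z -> continuous (fun w => g (u w)) z.
Proof.
  intros Hg Hu. apply continuous_comp; [exact Hu|]. exact (ex_derive_continuous (V := R_NormedModule) g (u z) Hg).
Qed.

Lemma continuous_sqd (c z : C) : continuous (sqd c) z.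
Proof.
  unfold sqd. apply continuous_Rplus.
  - apply (continuous_derivable (fun x => (x - Re c) ^ 2) Re); [auto_derive; trivial|apply continuous_Re].
  - apply (continuous_derivable (fun x => (x - Im c) ^ 2) Im); [auto_derive; trivial|apply continuous_Im].
Qed.

Lemma locally_lt {T : UniformSpace} (f : T -> R) (z : T) (b : R) :
  continuous f z -> f z < b -> locally z (fun w => f w < b).
Proof.
  intros Hc Hb. exact (Hc (fun y => y < b) (open_lt b (f z) Hb)).
Qed.

Lemma locally_gt {T : UniformSpace} (f : T -> R) (z : T) (b : R) :
  continuous f z -> b < f z -> locally z (fun w => b < f w).
Proof.
  intros Hc Hb. exact (Hc (fun y => b < y) (open_gt b (f z) Hb)).
Qed.

Lemma open_disc (c : C) (r : R) : open (fun z => sqd c z < r ^ 2).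
Proof. intros z Hz. apply locally_lt; [apply continuous_sqd|exact Hz]. Qed.

(** * Extreme values on closed discs *)

(** The disc sits in a box, for which a finite subcover is available. A point of the box outside the
    disc gets a radius so small that its neighbourhood misses the disc; hence continuity of [f] on
    the disc suffices. *)
Lemma closed_disc_bounded_above (c : C) (r : R) (f : C -> R) :
  0 < r -> (forall z, sqd c z <= r ^ 2 -> continuous f z) ->
  exists M, forall z, sqd c z <= r ^ 2 -> f z <= M.
Proof.
  intros Hr Hf.
  assert (Hloc : forall t : Compactness.Tn 2 R, exists d : posreal,
    forall z : C, Rabs (Re z - fst t) < d -> Rabs (Im z - fst (snd t)) < d ->
      sqd c z <= r ^ 2 -> f z <= f (fst t, fst (snd t)) + 1).
  { intros [t1 [t2 []]]. cbn [fst snd].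
    destruct (Rle_or_lt (sqd c (t1, t2)) (r ^ 2)) as [Hin|Hout].
    - destruct (proj1 (locally_C_iff _ _) (locally_lt f (t1, t2) (f (t1, t2) + 1) (Hf _ Hin) ltac:(lra))) as [d Hd].
      exists d. intros [x y] Hx Hy _. left. now apply Hd.
    - destruct (proj1 (locally_C_iff _ _) (locally_gt _ (t1, t2) _ (continuous_sqd c _) Hout)) as [d Hd].
      exists d. intros [x y] Hx Hy Hz. exfalso. specialize (Hd x y Hx Hy). lra. }
  pose (delta := fun t => proj1_sig (constructive_indefinite_description _ (Hloc t))).
  (* [compactness_list] provides the finite cover only under a double negation. *)
  apply NNPP. intros Hno.
  apply (compactness_list 2 (Re c - r, (Im c - r, tt)) (Re c + r, (Im c + r, tt)) delta).
  intros [l Hl]. apply Hno.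
  assert (Hmax : exists M, forall t, List.In t l -> f (fst t, fst (snd t)) + 1 <= M).
  { clear Hl. induction l as [|t l [M HM]].
    - exists 0. intros t [].
    - exists (Rmax M (f (fst t, fst (snd t)) + 1)). intros t' [<-|Ht'].
      + apply Rmax_r.
      + apply Rle_trans with M; [now apply HM|apply Rmax_l]. }
  destruct Hmax as [M HM]. exists M. intros z Hz.
  assert (Hb : bounded_n 2 (Re c - r, (Im c - r, tt)) (Re c + r, (Im c + r, tt)) (Re z, (Im z, tt))).
  { pose proof (sqd_le_box c z r Hr Hz). cbn. repeat split; lra. }
  destruct (Hl _ Hb) as (t & Ht & _ & Hcl).
  apply Rle_trans with (2 := HM t Ht).
  destruct t as [t1 [t2 []]]. destruct Hcl as (H1 & H2 & _).
  exact (proj2_sig (constructive_indefinite_description _ (Hloc (t1, (t2, tt)))) z H1 H2 Hz).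
Qed.

(** With [s = sup (- f)], an infimum [- s] that is not attained would make [/ (f + s)] continuous,
    hence bounded by some [M], and then [s - / M] would be a smaller upper bound of [- f]. *)
Lemma closed_disc_min (c : C) (r : R) (f : C -> R) :
  0 < r -> (forall z, sqd c z <= r ^ 2 -> continuous f z) ->
  exists m, sqd c m <= r ^ 2 /\ forall z, sqd c z <= r ^ 2 -> f m <= f z.
Proof.
  intros Hr Hf.
  destruct (closed_disc_bounded_above c r (fun z => - f z) Hr) as [B HB].
  { intros z Hz. apply (continuous_opp (V := R_NormedModule)), Hf, Hz. }
  destruct (completeness (fun y => exists z, sqd c z <= r ^ 2 /\ y = - f z)) as [s [Hub Hlub]].
  { exists B. intros y (z & Hz & ->). now apply HB. }
  { exists (- f c), c. split; [|easy]. rewrite sqd_refl. nra. }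
  apply NNPP. intros Hno.
  assert (Hlt : forall z, sqd c z <= r ^ 2 -> 0 < f z + s).
  { intros z Hz. apply Rnot_le_lt. intros Hle. apply Hno. exists z. split; [exact Hz|].
    intros w Hw. assert (- f w <= s) by (apply Hub; now exists w). lra. }
  destruct (closed_disc_bounded_above c r (fun z => / (f z + s)) Hr) as [M HM].
  { intros z Hz. apply (continuous_derivable (fun y => / (y + s)) f); [|now apply Hf].
    auto_derive. specialize (Hlt z Hz). lra. }
  assert (Hc : sqd c c <= r ^ 2) by (rewrite sqd_refl; nra).
  assert (HM0 : 0 < M).
  { apply Rlt_le_trans with (2 := HM c Hc). apply Rinv_0_lt_compat, Hlt, Hc. }
  assert (s <= s - / M).
  { apply Hlub. intros y (z & Hz & ->). specialize (HM z Hz). specialize (Hlt z Hz).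
    assert (/ M <= f z + s).
    { rewrite <- (Rinv_inv (f z + s)). apply Rinv_le_contravar; [now apply Rinv_0_lt_compat|exact HM]. }
    lra. }
  assert (0 < / M) by now apply Rinv_0_lt_compat. lra.
Qed.

(* Superharmonicity in the viscosity sense, tested only against [h + eps |. - z|^2] with [h] harmonic. *)
Definition superharmonic (D : C -> Prop) (s : C -> R) : Prop :=
  forall z, D z -> forall (N : C -> Prop) (h : C -> R) (eps : R),
    open N -> N z -> harmonic N h -> 0 < eps -> h z = s z ->
    ~ locally z (fun w => h w + eps * sqd z w <= s w).

(** A test function touching the minimum from below at [z] also touches from below whichever of the
    two functions is the smaller at [z]. *)
Lemma superharmonic_min (D : C -> Prop) (s t : C -> R) :
  superharmonic D s -> superharmonic D t -> superharmonic D (fun z => Rmin (s z) (t z)).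
Proof.
  intros Hs Ht z Dz N h eps oN Nz hN He Ez Hloc.
  destruct (Rle_dec (s z) (t z)) as [H|H].
  - apply (Hs z Dz N h eps oN Nz hN He).
    + rewrite Ez. now apply Rmin_left.
    + apply filter_imp with (2 := Hloc). intros w Hw. pose proof (Rmin_l (s w) (t w)). lra.
  - apply (Ht z Dz N h eps oN Nz hN He).
    + rewrite Ez. apply Rmin_right. lra.
    + apply filter_imp with (2 := Hloc). intros w Hw. pose proof (Rmin_r (s w) (t w)). lra.
Qed.

(** [g - eps (t - x)^2] has a local minimum at [x], so its derivative vanishes there. If
    [l < 2 eps], that derivative would be negative just to the right of [x], and the mean value
    theorem would make the function drop below its minimum. The second derivative is used at the
    single point [x]. *)
Lemma second_derive_ge (g g' : R -> R) (x l eps : R) :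
  locally x (fun t => is_derive g t (g' t)) -> is_derive g' x l ->
  locally x (fun t => g x + eps * (t - x) ^ 2 <= g t) -> 0 < eps -> 2 * eps <= l.
Proof.
  intros [d1 H1] H2 [d2 H3] He.
  set (k := fun t => g t - eps * (t - x) ^ 2). set (k' := fun t => g' t - 2 * eps * (t - x)).
  assert (Hk : forall t, Rabs (t - x) < d1 -> is_derive k t (k' t)).
  { intros t Ht. unfold k, k'.
    apply (is_derive_minus g (fun t => eps * (t - x) ^ 2)); [now apply H1|].
    auto_derive; trivial; ring. }
  assert (Hk' : is_derive k' x (l - 2 * eps)).
  { unfold k'. apply (is_derive_minus g' (fun t => 2 * eps * (t - x))); [exact H2|].
    auto_derive; trivial; ring. }
  assert (Hmin : forall t, Rabs (t - x) < d2 -> k x <= k t).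
  { intros t Ht. specialize (H3 t Ht). unfold k. replace ((x - x) ^ 2) with 0 by ring. lra. }
  set (d := Rmin d1 d2).
  assert (Hd : 0 < d) by (unfold d; apply Rmin_case; apply cond_pos).
  assert (Hd1 : d <= d1) by apply Rmin_l. assert (Hd2 : d <= d2) by apply Rmin_r.
  assert (K0 : k' x = 0).
  { rewrite <- (is_derive_unique _ _ _ (Hk x ltac:(rewrite Rminus_diag, Rabs_R0; apply cond_pos))).
    assert (Dk : derivable_pt k x).
    { exists (k' x). apply is_derive_Reals, Hk. rewrite Rminus_diag, Rabs_R0; apply cond_pos. }
    rewrite <- Derive_Reals with (pr := Dk).
    apply (deriv_minimum k (x - d) (x + d) x); try lra.
    intros t Ht1 Ht2. apply Hmin, Rabs_def1; lra. }
  apply Rnot_lt_le. intros Hl.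
  apply is_derive_Reals in Hk'.
  destruct (Hk' ((2 * eps - l) / 2) ltac:(lra)) as [d3 Hd3].
  set (e := Rmin d d3).
  assert (0 < e) by (unfold e; apply Rmin_case; [exact Hd|apply cond_pos]).
  assert (e <= d) by apply Rmin_l. assert (e <= d3) by apply Rmin_r.
  destruct (MVT_cor2 k k' x (x + e / 2)) as (xi & Heq & Hxi); [lra| |].
  { intros t Ht. apply is_derive_Reals, Hk, Rabs_def1; lra. }
  assert (k x <= k (x + e / 2)) by (apply Hmin, Rabs_def1; lra).
  specialize (Hd3 (xi - x) ltac:(lra) ltac:(apply Rabs_def1; lra)).
  replace (x + (xi - x)) with xi in Hd3 by ring. rewrite K0 in Hd3.
  apply Rabs_def2 in Hd3.
  set (q := (k' xi - 0) / (xi - x)) in *.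
  assert (k' xi = q * (xi - x)) by (unfold q; field; lra).
  assert (0 < - q * (xi - x)) by (apply Rmult_lt_0_compat; lra).
  assert (0 < - k' xi * (x + e / 2 - x)) by (apply Rmult_lt_0_compat; lra).
  lra.
Qed.

(** If [h + eps |. - z|^2] touched [k] from below, [k - h] would have both pure second derivatives
    at least [2 eps] at [z], against its Laplacian being zero. *)
Lemma harmonic_superharmonic (D : C -> Prop) (k : C -> R) :
  open D -> harmonic D k -> superharmonic D k.
Proof.
  intros oD hk z Dz N h eps oN Nz hN He Ez Hloc.
  set (M := fun w => D w /\ N w).
  assert (oM : open M) by now apply open_and.
  assert (hd : harmonic M (fun w => 1 * k w + (-1) * h w)).
  { apply harmonic_lin; trivial.
    - apply harmonic_subset with D; [now intros w []|trivial].
    - apply harmonic_subset with N; [now intros w []|trivial]. }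
  set (d := fun w => 1 * k w + (-1) * h w) in *.
  assert (Mz : M z) by now split.
  assert (d0 : d z = 0) by (unfold d; rewrite Ez; ring).
  assert (Hge : locally z (fun w => eps * sqd z w <= d w)).
  { apply filter_imp with (2 := Hloc). intros w Hw. unfold d. lra. }
  destruct hd as [(Cd & Cx & Cy) L]. specialize (L z Mz).
  assert (2 * eps <= dx (dx d) z).
  { apply (second_derive_ge (fun t => d (t, Im z)) (fun t => dx d (t, Im z)) (Re z)).
    - apply (locally_hor (fun w => is_derive (fun t => d (t, Im w)) (Re w) (dx d w))).
      apply (filter_imp M); [|now apply oM]. intros w Mw. apply (C1_on_partials M d w Cd Mw).
    - apply (C1_on_partials M (dx d) z Cx Mz).
    - apply locally_hor in Hge. apply filter_imp with (2 := Hge). intros t.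
      rewrite <- C_eta, d0. unfold sqd. cbn -[pow]. replace ((Im z - Im z) ^ 2) with 0 by ring. lra.
    - exact He. }
  assert (2 * eps <= dy (dy d) z).
  { apply (second_derive_ge (fun t => d (Re z, t)) (fun t => dy d (Re z, t)) (Im z)).
    - apply (locally_ver (fun w => is_derive (fun t => d (Re w, t)) (Im w) (dy d w))).
      apply (filter_imp M); [|now apply oM]. intros w Mw. apply (C1_on_partials M d w Cd Mw).
    - apply (C1_on_partials M (dy d) z Cy Mz).
    - apply locally_ver in Hge. apply filter_imp with (2 := Hge). intros t.
      rewrite <- C_eta, d0. unfold sqd. cbn -[pow]. replace ((Re z - Re z) ^ 2) with 0 by ring. lra.
    - exact He. }
  lra.
Qed.

(** Subtracting a small multiple of [|. - c|^2] from [s - h] pushes a negative minimum into the open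
    disc; at the minimiser the definition of [superharmonic] is contradicted. *)
Lemma minimum_principle (c : C) (r : R) (s h : C -> R) :
  0 < r ->
  (forall z, sqd c z <= r ^ 2 -> continuous s z) ->
  (forall z, sqd c z <= r ^ 2 -> continuous h z) ->
  superharmonic (fun z => sqd c z < r ^ 2) s -> harmonic (fun z => sqd c z < r ^ 2) h ->
  (forall z, sqd c z = r ^ 2 -> h z <= s z) ->
  forall z, sqd c z <= r ^ 2 -> h z <= s z.
Proof.
  intros Hr cs ch ss hh Hb z Hz. apply Rnot_lt_le. intros Hlt.
  assert (r2 : 0 < r ^ 2) by nra.
  (* On the boundary circle the penalty is [eps r^2], half of the violation at [z], so the penalised
     difference is larger there than at [z]. *)
  set (eps := (h z - s z) / (2 * r ^ 2)).
  assert (He : 0 < eps) by (apply Rdiv_lt_0_compat; lra).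
  assert (Her : eps * r ^ 2 = (h z - s z) / 2) by (unfold eps; field; nra).
  destruct (closed_disc_min c r (fun w => s w - h w - eps * sqd c w) Hr) as (m & Hm & Hmin).
  { intros w Hw. apply continuous_Rminus; [apply continuous_Rminus; auto|].
    apply continuous_Rmult; [apply continuous_const|apply continuous_sqd]. }
  assert (Hmr : sqd c m < r ^ 2).
  { apply Rnot_le_lt. intros Hge. assert (E : sqd c m = r ^ 2) by lra.
    specialize (Hb m E). specialize (Hmin z Hz). pose proof (sqd_pos c z).
    rewrite E in Hmin. assert (0 <= eps * sqd c z) by nra. lra. }
  (* [|w - c|^2 - |w - m|^2] is affine in [w], so [h + eps |w - c|^2] is a test function. *)
  set (a1 := 2 * eps * (Re m - Re c)). set (a2 := 2 * eps * (Im m - Im c)).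
  set (g := fun w : C => s m - h m - a1 * Re m - a2 * Im m + a1 * Re w + a2 * Im w).
  apply (ss m Hmr (fun w => sqd c w < r ^ 2) (fun w => 1 * h w + 1 * g w) eps); trivial.
  - apply open_disc.
  - apply harmonic_lin; [apply open_disc|exact hh|]. apply harmonic_affine, open_disc.
  - unfold g. ring.
  - apply (filter_imp (fun w => sqd c w < r ^ 2)); [|now apply open_disc].
    intros w Hw. specialize (Hmin w ltac:(lra)).
    unfold g, a1, a2, sqd in *. nra.
Qed.

Lemma harmonic_maximum (c : C) (r : R) (k h : C -> R) :
  0 < r ->
  (forall z, sqd c z <= r ^ 2 -> continuous k z) ->
  (forall z, sqd c z <= r ^ 2 -> continuous h z) ->
  harmonic (fun z => sqd c z < r ^ 2) k -> harmonic (fun z => sqd c z < r ^ 2) h ->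
  (forall z, sqd c z = r ^ 2 -> h z <= k z) ->
  forall z, sqd c z <= r ^ 2 -> h z <= k z.
Proof.
  intros Hr ck ch hk hh. apply minimum_principle; trivial.
  apply harmonic_superharmonic; [apply open_disc|exact hk].
Qed.

Lemma superharmonic_subset (D E : C -> Prop) (s : C -> R) :
  (forall z, E z -> D z) -> superharmonic D s -> superharmonic E s.
Proof. intros H Hs z Ez. apply Hs, H, Ez. Qed.

(** * Parametric integrals *)

Definition jointly_continuous (D : C -> Prop) (g : C -> R -> R) : Prop :=
  forall z t, D z -> continuous (fun p : C * R => g (fst p) (snd p)) (z, t).

Lemma jointly_continuous_param D g z t :
  jointly_continuous D g -> D z -> continuous (g z) t.
Proof.
  intros H Dz.
  apply (continuous_comp (fun t : R => (z, t) : C * R) (fun p => g (fst p) (snd p))).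
  - apply (continuous_comp_2 (fun _ : R => z) (fun t : R => t) (fun a b => (a, b) : C * R)).
    + apply continuous_const.
    + apply continuous_id.
    + apply continuous_ext with (fun p : C * R => p); [now intros []|apply continuous_id].
  - now apply H.
Qed.

Lemma jointly_continuous_ex_RInt D g z a b :
  jointly_continuous D g -> D z -> ex_RInt (g z) a b.
Proof.
  intros H Dz. apply (ex_RInt_continuous (V := R_CompleteNormedModule)).
  intros t _. now apply jointly_continuous_param with D.
Qed.

(** Compactness of [[a, b]] gives one radius around [z] that works for all [t]. Comparing [g w t]
    and [g z t] through the value at a tag costs [2 e], so the integrals differ by at most
    [eps / 2]. *)
Lemma continuous_RInt_param (D : C -> Prop) (g : C -> R -> R) (a b : R) (z : C) :
  open D -> a < b -> jointly_continuous D g -> D z ->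
  continuous (fun w => RInt (g w) a b) z.
Proof.
  intros oD Hab Hg Dz.
  apply filterlim_locally. intros eps.
  set (e := eps / (4 * (b - a))).
  assert (He : 0 < e) by (apply Rdiv_lt_0_compat; [apply cond_pos|lra]).
  assert (Hloc : forall t, exists d : posreal, forall w t', ball z d w -> ball t d t' ->
     Rabs (g w t' - g z t) < e).
  { intros t. destruct (proj1 (filterlim_locally _ _) (Hg z t Dz) (mkposreal e He)) as [d Hd].
    exists d. intros w t' Hw Ht'. apply (Hd (w, t')). now split. }
  pose (delta := fun t => proj1_sig (constructive_indefinite_description _ (Hloc t))).
  destruct (compactness_value_1d a b delta) as [d Hd].
  assert (oDz := oD z Dz).
  destruct oDz as [d' Hd'].
  assert (Hmin : 0 < Rmin d d') by (apply Rmin_case; apply cond_pos).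
  exists (mkposreal _ Hmin). intros w Hw.
  assert (Hw1 : ball z d w) by (apply ball_le with (2 := Hw); apply Rmin_l).
  assert (Hw2 : D w) by (apply Hd'; apply ball_le with (2 := Hw); apply Rmin_r).
  assert (Hdiff : forall t, a <= t <= b -> Rabs (g w t - g z t) <= 2 * e).
  { intros t Ht. apply Rnot_lt_le. intros Hlt. apply (Hd t Ht). intros (t0 & Ht0 & Hc & Hle).
    assert (Hdl := proj2_sig (constructive_indefinite_description _ (Hloc t0))).
    fold (delta t0) in Hdl. cbn beta in Hdl.
    assert (B1 := Hdl w t (ball_le _ _ _ Hle _ Hw1) Hc).
    assert (B2 := Hdl z t (ball_center _ _) Hc).
    apply Rabs_def2 in B1. apply Rabs_def2 in B2.
    assert (Rabs (g w t - g z t) < 2 * e) by (apply Rabs_def1; lra). lra. }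
  change (Rabs (RInt (g w) a b - RInt (g z) a b) < eps).
  assert (I1 : ex_RInt (g w) a b) by now apply jointly_continuous_ex_RInt with D.
  assert (I2 : ex_RInt (g z) a b) by now apply jointly_continuous_ex_RInt with D.
  replace (RInt (g w) a b - RInt (g z) a b) with (RInt (fun t => g w t - g z t) a b)
    by exact (RInt_minus (g w) (g z) a b I1 I2).
  apply Rle_lt_trans with ((b - a) * (2 * e)).
  - apply abs_RInt_le_const; [lra| |exact Hdiff].
    exact (ex_RInt_minus (g w) (g z) a b I1 I2).
  - unfold e. replace ((b - a) * (2 * (eps / (4 * (b - a))))) with (eps / 2) by (field; lra).
    pose proof (cond_pos eps). lra.
Qed.

Lemma continuous_pair {T U V : UniformSpace} (f : T -> U) (g : T -> V) (x : T) :
  continuous f x -> continuous g x -> continuous (fun w => (f w, g w)) x.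
Proof.
  intros Hf Hg. apply (continuous_comp_2 f g (fun a b => (a, b))); trivial.
  apply continuous_ext with (fun p : U * V => p); [now intros []|apply continuous_id].
Qed.

Lemma is_derive_RInt_continuous (P : R -> Prop) (g g' : R -> R -> R) (a b x : R) :
  a < b -> locally x P ->
  (forall u t, P u -> is_derive (fun v => g v t) u (g' u t)) ->
  (forall t, continuous (fun p : R * R => g' (fst p) (snd p)) (x, t)) ->
  (forall u t, P u -> continuous (g u) t) ->
  is_derive (fun u => RInt (g u) a b) x (RInt (g' x) a b).
Proof.
  intros Hab HP Hd Hc Hi.
  assert (Px := locally_singleton _ _ HP).
  replace (RInt (g' x) a b) with (RInt (fun t => Derive (fun u => g u t) x) a b).
  2: { apply RInt_ext. intros t _. now apply is_derive_unique, Hd. }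
  apply is_derive_RInt_param.
  - apply filter_imp with (2 := HP). intros u Pu t _. eexists. now apply Hd.
  - intros t _. apply continuity_2d_pt_ext_loc with (f := g').
    + destruct HP as [d HP]. exists d. intros u v Hu _. symmetry.
      apply is_derive_unique, Hd, HP. exact Hu.
    + apply continuity_2d_pt_filterlim. exact (Hc t).
  - apply filter_imp with (2 := HP). intros u Pu.
    apply (ex_RInt_continuous (V := R_CompleteNormedModule)). intros t _. now apply Hi.
Qed.

Lemma has_partials_RInt (D : C -> Prop) (g gx gy : C -> R -> R) (a b : R) (z : C) :
  open D -> a < b ->
  jointly_continuous D g -> jointly_continuous D gx -> jointly_continuous D gy ->
  (forall w t, D w -> has_partials (fun w => g w t) (fun w => gx w t) (fun w => gy w t) w) ->
  D z ->
  has_partials (fun w => RInt (g w) a b) (fun w => RInt (gx w) a b) (fun w => RInt (gy w) a b) z.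
Proof.
  intros oD Hab cg cx cy Hp Dz.
  split.
  - rewrite (C_eta z) at 2.
    apply (is_derive_RInt_continuous (fun u => D (u, Im z)) (fun u => g (u, Im z)) (fun u => gx (u, Im z))).
    + exact Hab.
    + apply (locally_hor D). now apply oD.
    + intros u t Du. exact (proj1 (Hp (u, Im z) t Du)).
    + intros t.
      apply (continuous_comp (fun p : R * R => ((fst p, Im z), snd p) : C * R) (fun p => gx (fst p) (snd p))).
      * apply continuous_pair; [|apply continuous_snd].
        apply (continuous_pair (U := R_UniformSpace) (V := R_UniformSpace)); [apply continuous_fst|apply continuous_const].
      * cbn [fst snd]. apply cx. now rewrite <- C_eta.
    + intros u t Du. now apply jointly_continuous_param with D.
  - rewrite (C_eta z) at 2.
    apply (is_derive_RInt_continuous (fun u => D (Re z, u)) (fun u => g (Re z, u)) (fun u => gy (Re z, u))).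
    + exact Hab.
    + apply (locally_ver D). now apply oD.
    + intros u t Du. exact (proj2 (Hp (Re z, u) t Du)).
    + intros t.
      apply (continuous_comp (fun p : R * R => ((Re z, fst p), snd p) : C * R) (fun p => gy (fst p) (snd p))).
      * apply continuous_pair; [|apply continuous_snd].
        apply (continuous_pair (U := R_UniformSpace) (V := R_UniformSpace)); [apply continuous_const|apply continuous_fst].
      * cbn [fst snd]. apply cy. now rewrite <- C_eta.
    + intros u t Du. now apply jointly_continuous_param with D.
Qed.

Lemma RInt_minus_R (f g : R -> R) a b : ex_RInt f a b -> ex_RInt g a b ->
  RInt (fun t => f t - g t) a b = RInt f a b - RInt g a b.
Proof. exact (RInt_minus f g a b). Qed.

Lemma RInt_plus_R (f g : R -> R) a b : ex_RInt f a b -> ex_RInt g a b ->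
  RInt (fun t => f t + g t) a b = RInt f a b + RInt g a b.
Proof. exact (RInt_plus f g a b). Qed.

Lemma RInt_scal_R (f : R -> R) k a b : ex_RInt f a b ->
  RInt (fun t => k * f t) a b = k * RInt f a b.
Proof. exact (RInt_scal f a b k). Qed.

Lemma RInt_opp_R (f : R -> R) a b : ex_RInt f a b -> RInt (fun t => - f t) a b = - RInt f a b.
Proof. exact (RInt_opp f a b). Qed.

Lemma RInt_const_R a b k : RInt (fun _ => k) a b = (b - a) * k.
Proof. exact (RInt_const a b k). Qed.

Lemma ex_RInt_continuous_fun (f : R -> R) a b : (forall t, continuous f t) -> ex_RInt f a b.
Proof. intros cf. apply (ex_RInt_continuous (V := R_CompleteNormedModule)). intros t _. apply cf. Qed.

(** * The Poisson integral *)

Definition circle (c : C) (r t : R) : C := (Re c + r * cos t, Im c + r * sin t).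

(* [(qre, qim)] is [q = 1 / (circle c r t - z)], and [(q2re, q2im)], [(q3re, q3im)] are its powers. *)
Definition qre (c : C) (r : R) (z : C) (t : R) : R :=
  (Re c + r * cos t - Re z) / sqd z (circle c r t).
Definition qim (c : C) (r : R) (z : C) (t : R) : R :=
  - (Im c + r * sin t - Im z) / sqd z (circle c r t).
Definition q2re c r z t := qre c r z t * qre c r z t - qim c r z t * qim c r z t.
Definition q2im c r z t := 2 * (qre c r z t * qim c r z t).
Definition q3re c r z t := q2re c r z t * qre c r z t - q2im c r z t * qim c r z t.
Definition q3im c r z t := q2re c r z t * qim c r z t + q2im c r z t * qre c r z t.

(** For [a + i b] a power of [q] this is [Re ((A - i B) (a + i b))]. Multiplying by [i] replaces the
    pair [(A, B)] by [(B, - A)], which is how y-derivatives appear below. *)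
Definition kernel_comb (a b : C -> R -> R) (A B : R -> R) (z : C) (t : R) : R :=
  A t * a z t + B t * b z t.

Lemma sqd_circle_pos c r z t : sqd c z < r ^ 2 -> 0 < sqd z (circle c r t).
Proof.
  intros H. destruct (Rle_lt_or_eq_dec _ _ (sqd_pos z (circle c r t))) as [Hl|He]; [exact Hl|exfalso].
  assert (S0 : forall a b, 0 = a ^ 2 + b ^ 2 -> a = 0 /\ b = 0).
  { intros a b E. split; apply NNPP; intros Hn; apply pow2_gt_0 in Hn;
      pose proof (pow2_ge_0 a); pose proof (pow2_ge_0 b); lra. }
  apply S0 in He. destruct He as [Ea Eb]. unfold circle in Ea, Eb. unfold sqd in H.
  replace (Re z - Re c) with (r * cos t) in H by (cbn in *; lra).
  replace (Im z - Im c) with (r * sin t) in H by (cbn in *; lra).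
  pose proof (sin2_cos2 t) as E. unfold Rsqr in E.
  replace ((r * cos t) ^ 2 + (r * sin t) ^ 2) with (r ^ 2 * (sin t * sin t + cos t * cos t)) in H by ring.
  rewrite E in H. lra.
Qed.

(** [q] is analytic in [z] with [q' = q^2]: its x-derivative is [q^2] and its y-derivative [i q^2].
    Likewise [(q^2)' = 2 q^3] further down. *)
Lemma has_partials_q c r z t : sqd c z < r ^ 2 ->
  has_partials (fun w => qre c r w t) (fun w => q2re c r w t) (fun w => - q2im c r w t) z /\
  has_partials (fun w => qim c r w t) (fun w => q2im c r w t) (fun w => q2re c r w t) z.
Proof.
  intros H. pose proof (sqd_circle_pos c r z t H) as Hp.
  unfold has_partials, q2re, q2im, qre, qim.
  unfold sqd, circle in *. cbn [fst snd Re Im] in *. unfold Re, Im in *.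
  destruct z as [x y], c as [c1 c2]. cbn [fst snd] in *.
  split; split; auto_derive. 1, 3, 5, 7: intros E0; cbn in *; lra. all: field; intros E0; cbn in *; lra.
Qed.

Lemma has_partials_mult (u v ux uy vx vy : C -> R) (z : C) :
  has_partials u ux uy z -> has_partials v vx vy z ->
  has_partials (fun w => u w * v w) (fun w => ux w * v w + u w * vx w)
    (fun w => uy w * v w + u w * vy w) z.
Proof.
  intros [H1 H2] [H3 H4]. rewrite (C_eta z) in *. cbn [Re Im fst snd] in *. split.
  - apply (is_derive_mult (fun t => u (t, _)) (fun t => v (t, _))); trivial. intros; apply Rmult_comm.
  - apply (is_derive_mult (fun t => u (_, t)) (fun t => v (_, t))); trivial. intros; apply Rmult_comm.
Qed.

Lemma has_partials_eq (u ux uy vx vy : C -> R) (z : C) :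
  has_partials u ux uy z -> ux z = vx z -> uy z = vy z -> has_partials u vx vy z.
Proof.
  intros H Ex Ey. apply has_partials_ext_loc with (4 := H); trivial.
  now apply filter_forall.
Qed.

Lemma has_partials_q2 c r z t : sqd c z < r ^ 2 ->
  has_partials (fun w => q2re c r w t) (fun w => 2 * q3re c r w t) (fun w => - (2 * q3im c r w t)) z /\
  has_partials (fun w => q2im c r w t) (fun w => 2 * q3im c r w t) (fun w => 2 * q3re c r w t) z.
Proof.
  intros H. destruct (has_partials_q c r z t H) as [Ha Hb]. split.
  - refine (has_partials_ext_loc _ _ _ _ _ _ z _ _ _
      (has_partials_lin 1 (-1) _ _ _ _ _ _ z (has_partials_mult _ _ _ _ _ _ z Ha Ha)
                (has_partials_mult _ _ _ _ _ _ z Hb Hb))).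
    + apply filter_forall. intros w. unfold q2re. ring.
    + cbn beta; unfold q3re; ring.
    + cbn beta; unfold q3im; ring.
  - refine (has_partials_ext_loc _ _ _ _ _ _ z _ _ _
      (has_partials_lin 2 0 _ _ _ _ _ _ z (has_partials_mult _ _ _ _ _ _ z Ha Hb)
                (has_partials_mult _ _ _ _ _ _ z Hb Hb))).
    + apply filter_forall. intros w. unfold q2im. ring.
    + cbn beta; unfold q3im; ring.
    + cbn beta; unfold q3re; ring.
Qed.

Lemma jointly_continuous_plus D f g :
  jointly_continuous D f -> jointly_continuous D g -> jointly_continuous D (fun z t => f z t + g z t).
Proof. intros Hf Hg z t Dz. apply continuous_Rplus; [now apply Hf|now apply Hg]. Qed.

Lemma jointly_continuous_mult D f g :
  jointly_continuous D f -> jointly_continuous D g -> jointly_continuous D (fun z t => f z t * g z t).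
Proof. intros Hf Hg z t Dz. apply continuous_Rmult; [now apply Hf|now apply Hg]. Qed.

Lemma jointly_continuous_minus D f g :
  jointly_continuous D f -> jointly_continuous D g -> jointly_continuous D (fun z t => f z t - g z t).
Proof. intros Hf Hg z t Dz. apply continuous_Rminus; [now apply Hf|now apply Hg]. Qed.

Lemma jointly_continuous_opp D f :
  jointly_continuous D f -> jointly_continuous D (fun z t => - f z t).
Proof. intros Hf z t Dz. apply (continuous_opp (V := R_NormedModule)). now apply Hf. Qed.

Lemma jointly_continuous_of_param D (f : R -> R) :
  (forall t, continuous f t) -> jointly_continuous D (fun _ t => f t).
Proof.
  intros Hf z t Dz. apply (continuous_comp (fun p : C * R => snd p) f); [apply continuous_snd|apply Hf].
Qed.

Lemma jointly_continuous_of_point D (f : C -> R) :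
  (forall z, D z -> continuous f z) -> jointly_continuous D (fun z _ => f z).
Proof.
  intros Hf z t Dz. apply (continuous_comp (fun p : C * R => fst p) f); [apply continuous_fst|now apply Hf].
Qed.

Lemma jointly_continuous_const D (k : R) : jointly_continuous D (fun _ _ => k).
Proof. intros z t Dz. apply continuous_const. Qed.

Lemma continuous_cos_R t : continuous cos t.
Proof. apply (ex_derive_continuous cos). auto_derive. trivial. Qed.

Lemma continuous_sin_R t : continuous sin t.
Proof. apply (ex_derive_continuous sin). auto_derive. trivial. Qed.

Lemma jointly_continuous_inv D f :
  jointly_continuous D f -> (forall z t, D z -> f z t <> 0) -> jointly_continuous D (fun z t => / f z t).
Proof.
  intros Hf H0 z t Dz.
  apply (continuous_derivable Rinv (fun p : C * R => f (fst p) (snd p))); [|now apply Hf].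
  auto_derive. now apply H0.
Qed.

Ltac joint_cont := repeat first
  [ assumption
  | apply jointly_continuous_const
  | apply (jointly_continuous_of_param _ cos), continuous_cos_R
  | apply (jointly_continuous_of_param _ sin), continuous_sin_R
  | apply (jointly_continuous_of_point _ Re); intros; apply continuous_Re
  | apply (jointly_continuous_of_point _ Im); intros; apply continuous_Im
  | apply jointly_continuous_plus
  | apply jointly_continuous_minus
  | apply jointly_continuous_mult
  | apply jointly_continuous_opp ].

Lemma jointly_continuous_sqd_circle D c r : jointly_continuous D (fun z t => sqd z (circle c r t)).
Proof. unfold sqd, circle. cbn [Re Im fst snd pow]. joint_cont. Qed.

Lemma jointly_continuous_q c r :
  jointly_continuous (fun z => sqd c z < r ^ 2) (qre c r) /\
  jointly_continuous (fun z => sqd c z < r ^ 2) (qim c r).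
Proof.
  assert (H : jointly_continuous (fun z => sqd c z < r ^ 2) (fun z t => / sqd z (circle c r t))).
  { apply jointly_continuous_inv; [apply jointly_continuous_sqd_circle|].
    intros z t Hz. apply Rgt_not_eq, sqd_circle_pos, Hz. }
  split; apply jointly_continuous_mult; trivial.
  - joint_cont.
  - joint_cont.
Qed.

Lemma jointly_continuous_q2 c r :
  jointly_continuous (fun z => sqd c z < r ^ 2) (q2re c r) /\
  jointly_continuous (fun z => sqd c z < r ^ 2) (q2im c r).
Proof. destruct (jointly_continuous_q c r). split; unfold q2re, q2im; joint_cont. Qed.

Lemma jointly_continuous_q3 c r :
  jointly_continuous (fun z => sqd c z < r ^ 2) (q3re c r) /\
  jointly_continuous (fun z => sqd c z < r ^ 2) (q3im c r).
Proof.
  destruct (jointly_continuous_q c r). destruct (jointly_continuous_q2 c r).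
  split; unfold q3re, q3im; joint_cont.
Qed.

Lemma jointly_continuous_comb D a b A B :
  jointly_continuous D a -> jointly_continuous D b ->
  (forall t, continuous A t) -> (forall t, continuous B t) ->
  jointly_continuous D (kernel_comb a b A B).
Proof.
  intros. apply jointly_continuous_plus; apply jointly_continuous_mult; trivial;
    now apply jointly_continuous_of_param.
Qed.

Lemma TwoPI_pos : 0 < 2 * PI.
Proof. pose proof PI_RGT_0. lra. Qed.

Lemma has_partials_RInt_q c r A B z :
  (forall t, continuous A t) -> (forall t, continuous B t) -> sqd c z < r ^ 2 ->
  has_partials (fun w => RInt (kernel_comb (qre c r) (qim c r) A B w) 0 (2 * PI))
    (fun w => RInt (kernel_comb (q2re c r) (q2im c r) A B w) 0 (2 * PI))
    (fun w => RInt (kernel_comb (q2re c r) (q2im c r) B (fun t => - A t) w) 0 (2 * PI)) z.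
Proof.
  intros cA cB Hz.
  assert (cA' : forall t, continuous (fun t => - A t) t).
  { intros t. apply (continuous_opp (V := R_NormedModule)), cA. }
  destruct (jointly_continuous_q c r), (jointly_continuous_q2 c r).
  apply (has_partials_RInt (fun z => sqd c z < r ^ 2)).
  - apply open_disc.
  - apply TwoPI_pos.
  - now apply jointly_continuous_comb.
  - now apply jointly_continuous_comb.
  - now apply jointly_continuous_comb.
  - intros w t Dw. destruct (has_partials_q c r w t Dw) as [Ha Hb].
    apply has_partials_eq with (1 := has_partials_lin (A t) (B t) _ _ _ _ _ _ w Ha Hb);
      unfold kernel_comb; ring.
  - exact Hz.
Qed.

Lemma has_partials_RInt_q2 c r A B z :
  (forall t, continuous A t) -> (forall t, continuous B t) -> sqd c z < r ^ 2 ->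
  has_partials (fun w => RInt (kernel_comb (q2re c r) (q2im c r) A B w) 0 (2 * PI))
    (fun w => RInt (kernel_comb (q3re c r) (q3im c r) (fun t => 2 * A t) (fun t => 2 * B t) w) 0 (2 * PI))
    (fun w => RInt (kernel_comb (q3re c r) (q3im c r) (fun t => 2 * B t) (fun t => - (2 * A t)) w) 0 (2 * PI)) z.
Proof.
  intros cA cB Hz.
  assert (c2 : forall F : R -> R, (forall t, continuous F t) -> forall t, continuous (fun t => 2 * F t) t).
  { intros F cF t. apply continuous_Rmult; [apply continuous_const|apply cF]. }
  assert (cA' : forall t, continuous (fun t => - (2 * A t)) t).
  { intros t. apply (continuous_opp (V := R_NormedModule)), c2, cA. }
  destruct (jointly_continuous_q2 c r), (jointly_continuous_q3 c r).
  apply (has_partials_RInt (fun z => sqd c z < r ^ 2)).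
  - apply open_disc.
  - apply TwoPI_pos.
  - now apply jointly_continuous_comb.
  - apply jointly_continuous_comb; auto.
  - apply jointly_continuous_comb; auto.
  - intros w t Dw. destruct (has_partials_q2 c r w t Dw) as [Ha Hb].
    apply has_partials_eq with (1 := has_partials_lin (A t) (B t) _ _ _ _ _ _ w Ha Hb);
      unfold kernel_comb; ring.
  - exact Hz.
Qed.

(** Two differentiations under the integral sign. The second y-derivative carries the factor
    [i^2 = -1] relative to the second x-derivative, whence the Laplace equation. *)
Lemma harmonic_RInt_q c r A B :
  (forall t, continuous A t) -> (forall t, continuous B t) ->
  harmonic (fun z => sqd c z < r ^ 2)
    (fun w => RInt (kernel_comb (qre c r) (qim c r) A B w) 0 (2 * PI)).
Proof.
  intros cA cB.
  assert (c2 : forall F : R -> R, (forall t, continuous F t) -> forall t, continuous (fun t => 2 * F t) t).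
  { intros F cF t. apply continuous_Rmult; [apply continuous_const|apply cF]. }
  assert (cn : forall F : R -> R, (forall t, continuous F t) -> forall t, continuous (fun t => - F t) t).
  { intros F cF t. apply (continuous_opp (V := R_NormedModule)), cF. }
  destruct (jointly_continuous_q2 c r), (jointly_continuous_q3 c r).
  assert (oD := open_disc c r).
  pose proof TwoPI_pos as HPI.
  eapply harmonic_intro; [exact oD | | | | | | | | | | ].
  - intros z Hz. now apply has_partials_RInt_q.
  - intros z Hz. now apply has_partials_RInt_q2.
  - intros z Hz. apply has_partials_RInt_q2; auto.
  - intros z Hz. apply continuous_RInt_param with (1 := oD); auto. now apply jointly_continuous_comb.
  - intros z Hz. apply continuous_RInt_param with (1 := oD); auto. apply jointly_continuous_comb; auto.
  - intros z Hz. apply continuous_RInt_param with (1 := oD); auto. apply jointly_continuous_comb; auto.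
  - intros z Hz. apply continuous_RInt_param with (1 := oD); auto. apply jointly_continuous_comb; auto.
  - intros z Hz. apply continuous_RInt_param with (1 := oD); auto.
    apply jointly_continuous_comb; auto.
  - intros z Hz. apply continuous_RInt_param with (1 := oD); auto.
    apply jointly_continuous_comb; auto.
  - intros z Hz. cbn beta.
    assert (J : jointly_continuous (fun z => sqd c z < r ^ 2)
      (kernel_comb (q3re c r) (q3im c r) (fun t => 2 * A t) (fun t => 2 * B t)))
      by (apply jointly_continuous_comb; auto).
    assert (E : RInt (kernel_comb (q3re c r) (q3im c r) (fun t => 2 * - A t) (fun t => - (2 * B t)) z) 0 (2 * PI)
      = - RInt (kernel_comb (q3re c r) (q3im c r) (fun t => 2 * A t) (fun t => 2 * B t) z) 0 (2 * PI)).
    { rewrite <- RInt_opp_R by exact (jointly_continuous_ex_RInt _ _ z 0 (2 * PI) J Hz).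
      apply RInt_ext. intros t _. unfold kernel_comb. cbn. ring. }
    rewrite E. ring.
Qed.

(** * The Poisson kernel: harmonicity, total mass, boundary barrier and Harnack bound *)

Definition poisson_kernel (c : C) (r : R) (z : C) (t : R) : R :=
  (r ^ 2 - sqd c z) / sqd z (circle c r t).

(* [P = -1 + 2 Re (zeta / (zeta - z))] with [zeta = r e^(it)]. *)
Lemma poisson_kernel_eq c r z t : sqd c z < r ^ 2 ->
  poisson_kernel c r z t =
  -1 + kernel_comb (qre c r) (qim c r) (fun t => 2 * r * cos t) (fun t => -2 * r * sin t) z t.
Proof.
  intros H. pose proof (sqd_circle_pos c r z t H) as Hp.
  unfold poisson_kernel, kernel_comb, qre, qim.
  assert (E : r ^ 2 - sqd c z = - sqd z (circle c r t)
    + 2 * r * cos t * (Re c + r * cos t - Re z) + 2 * r * sin t * (Im c + r * sin t - Im z)).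
  { pose proof (sin2_cos2 t) as E. unfold Rsqr in E. unfold sqd, circle. cbn -[pow].
    change (fst c) with (Re c). change (snd c) with (Im c). change (fst z) with (Re z). change (snd z) with (Im z).
    replace (r ^ 2) with (r ^ 2 * (sin t * sin t + cos t * cos t)) by (rewrite E; ring). ring. }
  rewrite E. field. lra.
Qed.

Lemma jointly_continuous_poisson_kernel c r :
  jointly_continuous (fun z => sqd c z < r ^ 2) (poisson_kernel c r).
Proof.
  unfold poisson_kernel. apply jointly_continuous_mult.
  - apply (jointly_continuous_of_point _ (fun z => r ^ 2 - sqd c z)). intros z _.
    apply continuous_Rminus; [apply continuous_const|apply continuous_sqd].
  - apply jointly_continuous_inv; [apply jointly_continuous_sqd_circle|].
    intros z t Hz. apply Rgt_not_eq, sqd_circle_pos, Hz.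
Qed.

Definition poisson (c : C) (r : R) (f : R -> R) (z : C) : R :=
  / (2 * PI) * RInt (fun t => poisson_kernel c r z t * f t) 0 (2 * PI).

Lemma poisson_ex_RInt c r f z : (forall t, continuous f t) -> sqd c z < r ^ 2 ->
  ex_RInt (fun t => poisson_kernel c r z t * f t) 0 (2 * PI).
Proof.
  intros cf Hz. apply (ex_RInt_continuous (V := R_CompleteNormedModule)). intros t _.
  apply continuous_Rmult; [|apply cf].
  now apply jointly_continuous_param with (1 := jointly_continuous_poisson_kernel c r).
Qed.

Lemma harmonic_poisson c r f : (forall t, continuous f t) ->
  harmonic (fun z => sqd c z < r ^ 2) (poisson c r f).
Proof.
  intros cf.
  set (A := fun t => 2 * r * cos t * f t). set (B := fun t => -2 * r * sin t * f t).
  assert (cA : forall t, continuous A t).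
  { intros t. apply continuous_Rmult; [|apply cf]. apply continuous_Rmult; [apply continuous_const|apply continuous_cos_R]. }
  assert (cB : forall t, continuous B t).
  { intros t. apply continuous_Rmult; [|apply cf]. apply continuous_Rmult; [apply continuous_const|apply continuous_sin_R]. }
  (* The [-1] in [poisson_kernel_eq] contributes minus the mean of [f], a constant, written here as
     an affine function. *)
  apply harmonic_ext with (fun z => / (2 * PI) * RInt (kernel_comb (qre c r) (qim c r) A B z) 0 (2 * PI) +
    1 * ((- / (2 * PI) * RInt f 0 (2 * PI)) + 0 * Re z + 0 * Im z)).
  - apply open_disc.
  - intros z Hz. unfold poisson.
    assert (J : ex_RInt (kernel_comb (qre c r) (qim c r) A B z) 0 (2 * PI)).
    { destruct (jointly_continuous_q c r).
      apply (jointly_continuous_ex_RInt (fun z => sqd c z < r ^ 2)); [now apply jointly_continuous_comb|exact Hz]. }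
    rewrite (RInt_ext (fun t => poisson_kernel c r z t * f t)
       (fun t => kernel_comb (qre c r) (qim c r) A B z t - f t)).
    + rewrite RInt_minus_R; [|exact J|now apply ex_RInt_continuous_fun]. ring.
    + intros t _. rewrite poisson_kernel_eq by exact Hz.
      unfold kernel_comb, A, B. cbn. ring.
  - apply harmonic_lin; [apply open_disc|now apply harmonic_RInt_q|].
    apply harmonic_affine, open_disc.
Qed.

Lemma RInt_periodic_derivative_0 (g g' : R -> R) :
  (forall t, is_derive g t (g' t)) -> (forall t, continuous g' t) -> g (2 * PI) = g 0 ->
  RInt g' 0 (2 * PI) = 0.
Proof.
  intros Hd Hc Hp.
  replace 0 with (g (2 * PI) - g 0) at 2 by (rewrite Hp; ring).
  apply is_RInt_unique. apply (is_RInt_derive g g'); auto.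
Qed.

(** With [zeta = r e^(it)] one has [dq/dt = - i zeta q^2], so [2 Re (zeta q^2)] and
    [-2 Im (zeta q^2)], which are the z-derivatives of the Poisson kernel, are t-derivatives of
    [-2 Im q] and [-2 Re q]. *)
Lemma is_derive_q c r z t : sqd c z < r ^ 2 ->
  is_derive (fun t => -2 * qim c r z t) t
    (kernel_comb (q2re c r) (q2im c r) (fun t => 2 * r * cos t) (fun t => -2 * r * sin t) z t) /\
  is_derive (fun t => -2 * qre c r z t) t
    (kernel_comb (q2re c r) (q2im c r) (fun t => -2 * r * sin t) (fun t => - (2 * r * cos t)) z t).
Proof.
  intros H. pose proof (sqd_circle_pos c r z t H) as Hp.
  unfold kernel_comb, q2re, q2im, qre, qim.
  unfold sqd, circle in *. cbn [fst snd Re Im] in *. unfold Re, Im in *.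
  destruct z as [x y], c as [c1 c2]. cbn [fst snd] in *.
  split; auto_derive. 1, 3: intros E0; cbn in *; lra. all: field; intros E0; cbn in *; lra.
Qed.

Lemma circle_periodic c r : circle c r (2 * PI) = circle c r 0.
Proof. unfold circle. now rewrite cos_2PI, sin_2PI, cos_0, sin_0. Qed.

Lemma qim_periodic c r z : qim c r z (2 * PI) = qim c r z 0.
Proof. unfold qim. now rewrite circle_periodic, sin_2PI, sin_0. Qed.

Lemma qre_periodic c r z : qre c r z (2 * PI) = qre c r z 0.
Proof. unfold qre. now rewrite circle_periodic, cos_2PI, cos_0. Qed.

Lemma continuous_scal_fun k (f : R -> R) : (forall t, continuous f t) -> forall t, continuous (fun t => k * f t) t.
Proof. intros cf t. apply continuous_Rmult; [apply continuous_const|apply cf]. Qed.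

(** The integrands of the gradient are t-derivatives of [2 PI]-periodic functions. Hence the total
    mass of the Poisson kernel does not depend on [z] and can be computed at the center, where the
    kernel is [1]. *)
Lemma RInt_kernel_gradient c r z : sqd c z < r ^ 2 ->
  has_partials (fun w => RInt (kernel_comb (qre c r) (qim c r) (fun t => 2 * r * cos t) (fun t => -2 * r * sin t) w) 0 (2 * PI))
   (fun _ => 0) (fun _ => 0) z.
Proof.
  intros Hz.
  assert (cA := continuous_scal_fun (2 * r) cos continuous_cos_R).
  assert (cB := continuous_scal_fun (-2 * r) sin continuous_sin_R).
  assert (cA' : forall t, continuous (fun t => - (2 * r * cos t)) t).
  { intros t. apply (continuous_opp (V := R_NormedModule)), cA. }
  destruct (jointly_continuous_q2 c r) as [Ja Jb].
  apply has_partials_eq with (1 := has_partials_RInt_q c r _ _ z cA cB Hz).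
  - apply (RInt_periodic_derivative_0 (fun t => -2 * qim c r z t)).
    + intros t. now apply is_derive_q.
    + intros t. apply (jointly_continuous_param (fun z => sqd c z < r ^ 2)); [|exact Hz].
      now apply jointly_continuous_comb.
    + now rewrite qim_periodic.
  - apply (RInt_periodic_derivative_0 (fun t => -2 * qre c r z t)).
    + intros t. now apply is_derive_q.
    + intros t. apply (jointly_continuous_param (fun z => sqd c z < r ^ 2)); [|exact Hz].
      now apply jointly_continuous_comb.
    + now rewrite qre_periodic.
Qed.

Lemma zero_derivative_eq (g : R -> R) (a b : R) :
  (forall t, Rmin a b <= t <= Rmax a b -> is_derive g t 0) -> g a = g b.
Proof.
  intros H. destruct (MVT_gen g a b (fun _ => 0)) as (xi & _ & E).
  - intros t Ht. apply H. lra.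
  - intros t Ht. apply continuity_pt_filterlim, (ex_derive_continuous g). eexists; now apply H.
  - lra.
Qed.

Lemma zero_gradient_disc (c : C) (r : R) (g : C -> R) (z : C) :
  (forall w, sqd c w < r ^ 2 -> has_partials g (fun _ => 0) (fun _ => 0) w) ->
  sqd c z < r ^ 2 -> g z = g c.
Proof.
  intros H Hz. unfold sqd in Hz.
  pose proof (pow2_ge_0 (Re z - Re c)) as P1. pose proof (pow2_ge_0 (Im z - Im c)) as P2.
  assert (Hsq : forall a b t, Rmin a b <= t <= Rmax a b -> (t - a) ^ 2 <= (b - a) ^ 2).
  { intros a b t. unfold Rmin, Rmax. destruct (Rle_dec a b); intros [? ?]; nra. }
  (* The path from [c] to [z] with its corner at [(Re z, Im c)] stays in the disc, since each
     coordinate difference only grows along it. *)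
  rewrite (C_eta z), (C_eta c). transitivity (g (Re z, Im c)).
  - symmetry. apply (zero_derivative_eq (fun t => g (Re z, t))). intros t Ht.
    apply (H (Re z, t)). unfold sqd. cbn -[pow]. apply Hsq in Ht.
    change (fst z) with (Re z). change (fst c) with (Re c). change (snd c) with (Im c). lra.
  - symmetry. apply (zero_derivative_eq (fun t => g (t, Im c))). intros t Ht.
    apply (H (t, Im c)). unfold sqd. cbn -[pow]. apply Hsq in Ht.
    change (fst z) with (Re z). change (fst c) with (Re c). change (snd c) with (Im c).
    replace ((Im c - Im c) ^ 2) with 0 by ring. lra.
Qed.

Lemma sqd_center_circle c r t : sqd c (circle c r t) = r ^ 2.
Proof.
  pose proof (sin2_cos2 t) as E. unfold Rsqr in E. unfold sqd, circle. cbn -[pow].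
  change (fst c) with (Re c). change (snd c) with (Im c).
  replace (Re c + r * cos t - Re c) with (r * cos t) by ring.
  replace (Im c + r * sin t - Im c) with (r * sin t) by ring.
  replace (r ^ 2) with (r ^ 2 * (sin t * sin t + cos t * cos t)) by (rewrite E; ring). ring.
Qed.

Lemma poisson_kernel_center c r t : 0 < r -> poisson_kernel c r c t = 1.
Proof.
  intros Hr. unfold poisson_kernel. rewrite sqd_center_circle, sqd_refl. field. lra.
Qed.

Lemma RInt_poisson_kernel c r z : 0 < r -> sqd c z < r ^ 2 ->
  RInt (poisson_kernel c r z) 0 (2 * PI) = 2 * PI.
Proof.
  intros Hr Hz.
  set (G := fun w => RInt (kernel_comb (qre c r) (qim c r) (fun t => 2 * r * cos t) (fun t => -2 * r * sin t) w) 0 (2 * PI)).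
  assert (E : forall w, sqd c w < r ^ 2 -> RInt (poisson_kernel c r w) 0 (2 * PI) = - (2 * PI) + G w).
  { intros w Hw. unfold G.
    assert (J : ex_RInt (kernel_comb (qre c r) (qim c r) (fun t => 2 * r * cos t) (fun t => -2 * r * sin t) w) 0 (2 * PI)).
    { destruct (jointly_continuous_q c r).
      apply (jointly_continuous_ex_RInt (fun z => sqd c z < r ^ 2)); [|exact Hw].
      apply jointly_continuous_comb; trivial; apply continuous_scal_fun;
        [apply continuous_cos_R|apply continuous_sin_R]. }
    rewrite (RInt_ext (poisson_kernel c r w) (fun t => -1 + kernel_comb (qre c r) (qim c r) (fun t => 2 * r * cos t) (fun t => -2 * r * sin t) w t)).
    - rewrite RInt_plus_R; [|apply ex_RInt_const|exact J]. rewrite RInt_const_R. cbn; ring.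
    - intros t _. now apply poisson_kernel_eq. }
  assert (Hc : sqd c c < r ^ 2) by (rewrite sqd_refl; nra).
  rewrite E by exact Hz.
  replace (G z) with (G c).
  - rewrite <- E by exact Hc. rewrite (RInt_ext _ (fun _ => 1)).
    + rewrite RInt_const_R. cbn. ring.
    + intros t _. now apply poisson_kernel_center.
  - symmetry. apply (zero_gradient_disc c r G); [|exact Hz]. intros w Hw. now apply RInt_kernel_gradient.
Qed.

Lemma poisson_kernel_nonneg c r z t : sqd c z < r ^ 2 -> 0 <= poisson_kernel c r z t.
Proof.
  intros Hz. pose proof (sqd_circle_pos c r z t Hz). apply Rlt_le, Rdiv_lt_0_compat; lra.
Qed.

Lemma poisson_minus c r f g z : (forall t, continuous f t) -> (forall t, continuous g t) ->
  sqd c z < r ^ 2 -> poisson c r (fun t => f t - g t) z = poisson c r f z - poisson c r g z.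
Proof.
  intros cf cg Hz. unfold poisson.
  rewrite (RInt_ext _ (fun t => poisson_kernel c r z t * f t - poisson_kernel c r z t * g t)).
  - rewrite RInt_minus_R by now apply poisson_ex_RInt. cbn. ring.
  - intros t _. cbn. ring.
Qed.

Lemma inv_2PI_pos : 0 < / (2 * PI).
Proof. apply Rinv_0_lt_compat, TwoPI_pos. Qed.

(* [sqd zeta (circle c r t) <= 2 sqd zeta z + 2 sqd z (circle c r t)], and the Poisson integral of the
   last function at [z] is [r ^ 2 - sqd c z]: this replaces the usual approximate-identity estimate. *)
Lemma poisson_barrier c r f z zeta alpha M : 0 < r -> (forall t, continuous f t) -> sqd c z < r ^ 2 ->
  0 <= M -> (forall t, f t <= alpha + M * sqd zeta (circle c r t)) ->
  poisson c r f z <= alpha + M * (2 * (r ^ 2 - sqd c z) + 2 * sqd zeta z).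
Proof.
  intros Hr cf Hz HM Hf. unfold poisson.
  pose proof inv_2PI_pos as HI. pose proof TwoPI_pos as HP.
  apply Rmult_le_reg_l with (2 * PI); [exact HP|].
  replace (2 * PI * (/ (2 * PI) * RInt (fun t => poisson_kernel c r z t * f t) 0 (2 * PI)))
    with (RInt (fun t => poisson_kernel c r z t * f t) 0 (2 * PI)) by (cbn; field; lra).
  set (C1 := alpha + M * (2 * sqd zeta z)). set (C2 := M * (2 * (r ^ 2 - sqd c z))).
  assert (cK : forall t, continuous (poisson_kernel c r z) t).
  { intros t. apply (jointly_continuous_param (fun z => sqd c z < r ^ 2)); [apply jointly_continuous_poisson_kernel|exact Hz]. }
  assert (I1 : ex_RInt (fun t => C1 * poisson_kernel c r z t) 0 (2 * PI)).
  { apply ex_RInt_continuous_fun, continuous_scal_fun, cK. }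
  apply Rle_trans with (RInt (fun t => C1 * poisson_kernel c r z t + C2) 0 (2 * PI)).
  - apply RInt_le.
    + lra.
    + now apply poisson_ex_RInt.
    + apply (ex_RInt_plus (V := R_CompleteNormedModule)); [exact I1|apply ex_RInt_const].
    + intros t _.
      pose proof (poisson_kernel_nonneg c r z t Hz) as K0.
      assert (K1 : poisson_kernel c r z t * sqd z (circle c r t) = r ^ 2 - sqd c z).
      { unfold poisson_kernel. field. apply Rgt_not_eq, sqd_circle_pos, Hz. }
      assert (T : sqd zeta (circle c r t) <= 2 * sqd zeta z + 2 * sqd z (circle c r t)).
      { unfold sqd. set (p := circle c r t).
        pose proof (pow2_ge_0 ((Re z - Re zeta) - (Re p - Re z))).
        pose proof (pow2_ge_0 ((Im z - Im zeta) - (Im p - Im z))). nra. }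
      unfold C1, C2. rewrite <- K1.
      apply Rle_trans with (poisson_kernel c r z t * (alpha + M * (2 * sqd zeta z + 2 * sqd z (circle c r t)))).
      * apply Rmult_le_compat_l; [exact K0|]. specialize (Hf t).
        pose proof (Rmult_le_compat_l M _ _ HM T). lra.
      * right. ring.
  - rewrite RInt_plus_R; [|exact I1|apply ex_RInt_const]. rewrite RInt_const_R.
    rewrite RInt_scal_R by now apply ex_RInt_continuous_fun.
    rewrite RInt_poisson_kernel by trivial. unfold C1, C2. right. cbn. ring.
Qed.

(** With [rho = |z - c|] the denominator is at least [(r - rho)^2], so the kernel is at most
    [(r + rho) / (r - rho)], which is [3] at [rho = r / 2]. *)
Lemma poisson_kernel_le_3 c r z t : 0 < r -> 4 * sqd c z <= r ^ 2 -> poisson_kernel c r z t <= 3.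
Proof.
  intros Hr Hz. assert (Hz' : sqd c z < r ^ 2) by (pose proof (sqd_pos c z); nra).
  pose proof (sqd_circle_pos c r z t Hz') as Hp.
  unfold poisson_kernel. apply Rle_div_l; [exact Hp|].
  set (X := Re z - Re c). set (Y := Im z - Im c).
  assert (E : sqd z (circle c r t) = r ^ 2 + sqd c z - 2 * r * (X * cos t + Y * sin t)).
  { pose proof (sin2_cos2 t) as E. unfold Rsqr in E. unfold sqd, circle, X, Y. cbn -[pow].
    change (fst c) with (Re c). change (snd c) with (Im c). change (fst z) with (Re z). change (snd z) with (Im z).
    replace (r ^ 2) with (r ^ 2 * (sin t * sin t + cos t * cos t)) by (rewrite E; ring). ring. }
  rewrite E. set (rho := sqrt (sqd c z)).
  assert (R0 : 0 <= rho) by apply sqrt_pos.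
  assert (R2 : rho * rho = sqd c z) by (apply sqrt_sqrt, sqd_pos).
  assert (Hcs : X * cos t + Y * sin t <= rho).
  { apply Rnot_lt_le. intros Hlt.
    assert (rho * rho < (X * cos t + Y * sin t) * (X * cos t + Y * sin t)) by nra.
    pose proof (sin2_cos2 t) as E1. unfold Rsqr in E1.
    (* Lagrange's identity, giving the Cauchy-Schwarz inequality for [(X, Y)] and
       [(cos t, sin t)]. *)
    assert (E2 : (X * cos t + Y * sin t) * (X * cos t + Y * sin t) + (X * sin t - Y * cos t) * (X * sin t - Y * cos t)
      = sqd c z * (sin t * sin t + cos t * cos t)) by (unfold sqd; fold X Y; ring).
    rewrite E1 in E2. pose proof (Rle_0_sqr (X * sin t - Y * cos t)) as Q. unfold Rsqr in Q. lra. }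
  assert (Hrho : 2 * rho <= r) by (apply Rnot_lt_le; intros Hlt; nra).
  rewrite <- R2.
  assert (r * (X * cos t + Y * sin t) <= r * rho) by (apply Rmult_le_compat_l; lra).
  nra.
Qed.

Lemma poisson_harnack c r f z : 0 < r -> (forall t, continuous f t) -> (forall t, 0 <= f t) ->
  4 * sqd c z <= r ^ 2 -> poisson c r f z <= 3 * poisson c r f c.
Proof.
  intros Hr cf f0 Hz. assert (Hz' : sqd c z < r ^ 2) by (pose proof (sqd_pos c z); nra).
  assert (Hc : sqd c c < r ^ 2) by (rewrite sqd_refl; nra).
  pose proof inv_2PI_pos as HI. pose proof TwoPI_pos as HP. unfold poisson.
  rewrite <- Rmult_assoc, (Rmult_comm 3), Rmult_assoc. apply Rmult_le_compat_l; [lra|].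
  rewrite <- RInt_scal_R by now apply poisson_ex_RInt.
  apply RInt_le; [lra|now apply poisson_ex_RInt| |].
  - apply (ex_RInt_scal (V := R_CompleteNormedModule) (fun t => poisson_kernel c r c t * f t)).
    now apply poisson_ex_RInt.
  - intros t _. rewrite poisson_kernel_center by exact Hr.
    rewrite Rmult_1_l. apply Rmult_le_compat_r; [apply f0|now apply poisson_kernel_le_3].
Qed.

(** * Least harmonic majorants *)

Definition poisson_mod (c : C) (r : R) (s : C -> R) (z : C) : R :=
  if Rlt_dec (sqd c z) (r ^ 2) then poisson c r (fun t => s (circle c r t)) z else s z.

Lemma poisson_mod_in c r s z : sqd c z < r ^ 2 ->
  poisson_mod c r s z = poisson c r (fun t => s (circle c r t)) z.
Proof. intros H. unfold poisson_mod. now destruct Rlt_dec. Qed.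

Lemma poisson_mod_out c r s z : r ^ 2 <= sqd c z -> poisson_mod c r s z = s z.
Proof. intros H. unfold poisson_mod. destruct Rlt_dec; [lra|reflexivity]. Qed.

Lemma continuous_on_circle c r (s : C -> R) :
  (forall z, sqd c z <= r ^ 2 -> continuous s z) -> forall t, continuous (fun t : R => s (circle c r t)) t.
Proof.
  intros cs t. apply (continuous_comp (circle c r) s).
  - apply (continuous_pair (U := R_UniformSpace) (V := R_UniformSpace)
      (fun t => Re c + r * cos t) (fun t => Im c + r * sin t)).
    + apply continuous_Rplus; [apply continuous_const|apply continuous_scal_fun, continuous_cos_R].
    + apply continuous_Rplus; [apply continuous_const|apply continuous_scal_fun, continuous_sin_R].
  - apply cs. rewrite sqd_center_circle. lra.
Qed.

Lemma harmonic_poisson_mod c r s :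
  (forall z, sqd c z <= r ^ 2 -> continuous s z) ->
  harmonic (fun z => sqd c z < r ^ 2) (poisson_mod c r s).
Proof.
  intros cs. apply harmonic_ext with (poisson c r (fun t => s (circle c r t))).
  - apply open_disc.
  - intros z Hz. symmetry. now apply poisson_mod_in.
  - apply harmonic_poisson. now apply continuous_on_circle.
Qed.

(** [ball] in [C] is a square; it contains the Euclidean disc of the same radius. *)
Lemma far_from_ball_sqd (z w : C) (d : posreal) : ~ ball z d w -> d ^ 2 <= sqd z w.
Proof.
  intros H. apply Rnot_lt_le. intros Hlt. apply H. unfold sqd in Hlt.
  assert (A : forall a b : R, a ^ 2 + b ^ 2 < d ^ 2 -> Rabs a < d).
  { intros a b Hab. pose proof (cond_pos d). pose proof (pow2_ge_0 b). apply Rabs_def1; nra. }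
  split.
  - apply (A _ _ Hlt).
  - rewrite Rplus_comm in Hlt. apply (A _ _ Hlt).
Qed.

(** On the circle [s] lies below [s zeta + eps / 2 + M |. - zeta|^2]. The bound that
    [poisson_barrier] derives from this tends to [s zeta + eps / 2] as [z] tends to [zeta]. *)
Lemma poisson_mod_boundary_upper c r s zeta eps : 0 < r ->
  (forall z, sqd c z <= r ^ 2 -> continuous s z) -> sqd c zeta = r ^ 2 -> 0 < eps ->
  locally zeta (fun z => sqd c z < r ^ 2 -> poisson c r (fun t => s (circle c r t)) z < s zeta + eps).
Proof.
  intros Hr cs Hzeta Heps.
  destruct (locally_lt s zeta (s zeta + eps / 2) (cs zeta ltac:(lra)) ltac:(lra)) as [d Hd].
  destruct (closed_disc_bounded_above c r s Hr cs) as [S HS].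
  set (S' := Rmax (S - s zeta) 0).
  assert (HS1 : S - s zeta <= S') by apply Rmax_l. assert (HS2 : 0 <= S') by apply Rmax_r.
  (* Chosen so that outside [ball zeta d] the quadratic term alone exceeds [S - s zeta], with [S] a
     bound of [s] on the disc. *)
  set (M := S' / d ^ 2).
  assert (Hd2 : 0 < d ^ 2) by (pose proof (cond_pos d); nra).
  assert (HM : 0 <= M) by (apply Rdiv_le_0_compat; lra).
  assert (Hf : forall t, s (circle c r t) <= (s zeta + eps / 2) + M * sqd zeta (circle c r t)).
  { intros t. pose proof (sqd_pos zeta (circle c r t)) as P.
    destruct (classic (ball zeta d (circle c r t))) as [Hb|Hb].
    - specialize (Hd _ Hb). cbn beta in Hd. nra.
    - apply far_from_ball_sqd in Hb.
      assert (S' <= M * sqd zeta (circle c r t)).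
      { replace S' with (M * d ^ 2) by (unfold M; field; pose proof (cond_pos d); lra). now apply Rmult_le_compat_l. }
      assert (s (circle c r t) <= S) by (apply HS; rewrite sqd_center_circle; lra). lra. }
  assert (Hlim : locally zeta (fun z => M * (2 * (r ^ 2 - sqd c z) + 2 * sqd zeta z) < eps / 2)).
  { apply locally_lt.
    - apply continuous_Rmult; [apply continuous_const|].
      apply continuous_Rplus; apply continuous_Rmult; try apply continuous_const.
      + apply continuous_Rminus; [apply continuous_const|apply continuous_sqd].
      + apply continuous_sqd.
    - rewrite Hzeta, sqd_refl. lra. }
  apply filter_imp with (2 := Hlim). intros z HMz Hz.
  pose proof (poisson_barrier c r _ z zeta _ M Hr (continuous_on_circle c r s cs) Hz HM Hf). lra.
Qed.

Lemma poisson_opp c r f z : (forall t, continuous f t) -> sqd c z < r ^ 2 ->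
  poisson c r (fun t => - f t) z = - poisson c r f z.
Proof.
  intros cf Hz. unfold poisson. rewrite Ropp_mult_distr_r. f_equal.
  rewrite <- RInt_opp_R by now apply poisson_ex_RInt.
  apply RInt_ext. intros t _. cbn. ring.
Qed.

Lemma poisson_mod_continuous (D : C -> Prop) c r s z : open D -> 0 < r ->
  (forall w, sqd c w <= r ^ 2 -> D w) -> (forall w, D w -> continuous s w) -> D z ->
  continuous (poisson_mod c r s) z.
Proof.
  intros oD Hr HD cs Dz.
  assert (cs' : forall w, sqd c w <= r ^ 2 -> continuous s w) by auto.
  destruct (Rtotal_order (sqd c z) (r ^ 2)) as [Hlt|[Heq|Hgt]].
  - apply (harmonic_continuous (fun z => sqd c z < r ^ 2)); [apply open_disc|now apply harmonic_poisson_mod|exact Hlt].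
  - apply filterlim_locally. intros eps.
    assert (He := cond_pos eps).
    assert (U := poisson_mod_boundary_upper c r s z eps Hr cs' Heq He).
    (* The lower boundary estimate is the upper one for [- s]. *)
    assert (L := poisson_mod_boundary_upper c r (fun w => - s w) z eps Hr
      (fun w Hw => continuous_opp (V := R_NormedModule) s w (cs' w Hw)) Heq He).
    assert (S := proj1 (filterlim_locally _ _) (cs z Dz) eps).
    generalize (filter_and _ _ U (filter_and _ _ L S)). apply filter_imp.
    intros w (Hu & Hl & Hs). change (Rabs (poisson_mod c r s w - poisson_mod c r s z) < eps).
    rewrite (poisson_mod_out c r s z) by lra.
    destruct (Rlt_le_dec (sqd c w) (r ^ 2)) as [Hw|Hw].
    + rewrite poisson_mod_in by exact Hw. specialize (Hu Hw). specialize (Hl Hw).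
      rewrite poisson_opp in Hl; [|now apply continuous_on_circle|exact Hw].
      apply Rabs_def1; lra.
    + rewrite poisson_mod_out by exact Hw. exact Hs.
  - apply continuous_ext_loc with s; [|now apply cs].
    apply (filter_imp (fun w => r ^ 2 < sqd c w)).
    + intros w Hw. symmetry. apply poisson_mod_out. lra.
    + apply locally_gt; [apply continuous_sqd|exact Hgt].
Qed.

Lemma poisson_mod_le (D : C -> Prop) c r s z : open D -> 0 < r ->
  (forall w, sqd c w <= r ^ 2 -> D w) -> (forall w, D w -> continuous s w) ->
  superharmonic D s -> poisson_mod c r s z <= s z.
Proof.
  intros oD Hr HD cs ss.
  destruct (Rlt_le_dec (sqd c z) (r ^ 2)) as [Hz|Hz]; [|rewrite poisson_mod_out by exact Hz; lra].
  apply (minimum_principle c r s (poisson_mod c r s)); trivial.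
  - auto.
  - intros w Hw. apply poisson_mod_continuous with D; auto.
  - apply superharmonic_subset with D; [|exact ss]. intros w Hw. apply HD. lra.
  - apply harmonic_poisson_mod. auto.
  - intros w Hw. rewrite poisson_mod_out; lra.
  - lra.
Qed.

(** Inside the open disc the modification is harmonic. Elsewhere, the circle included, it equals [s]
    at the point and is at most [s] everywhere, so a function touching it from below touches [s]
    from below. *)
Lemma poisson_mod_superharmonic (D : C -> Prop) c r s : open D -> 0 < r ->
  (forall w, sqd c w <= r ^ 2 -> D w) -> (forall w, D w -> continuous s w) ->
  superharmonic D s -> superharmonic D (poisson_mod c r s).
Proof.
  intros oD Hr HD cs ss z Dz N h eps oN Nz hN He Ez Hloc.
  destruct (Rlt_le_dec (sqd c z) (r ^ 2)) as [Hz|Hz].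
  - apply (harmonic_superharmonic (fun w => sqd c w < r ^ 2) (poisson_mod c r s)) with (z := z) (N := N) (h := h) (eps := eps); trivial.
    + apply open_disc.
    + apply harmonic_poisson_mod. auto.
  - apply (ss z Dz N h eps); trivial.
    + rewrite Ez. now apply poisson_mod_out.
    + apply filter_imp with (2 := Hloc). intros w Hw. apply Rle_trans with (1 := Hw).
      now apply poisson_mod_le with D.
Qed.

(** * The Perron class and its infimum *)

Definition max_of_harmonics (D : C -> Prop) (u : C -> R) : Prop :=
  forall z, D z -> exists l, harmonic D l /\ (forall w, D w -> l w <= u w) /\ l z = u z.

(** Continuity is included so that Poisson integrals of members make sense. All harmonic majorants
    of [u] are members, so the infimum of the class lies below each of them. *)
Definition perron (D : C -> Prop) (u s : C -> R) : Prop :=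
  (forall z, D z -> continuous s z) /\ superharmonic D s /\ (forall z, D z -> u z <= s z).

(** [max_of_harmonics] plays the part of subharmonicity: at a point [z] of the disc, the harmonic
    [l] with [l z = u z] lies below [s] on the circle, hence below the Poisson integral at [z]. *)
Lemma poisson_mod_perron D u c r s : open D -> max_of_harmonics D u -> 0 < r ->
  (forall w, sqd c w <= r ^ 2 -> D w) -> perron D u s -> perron D u (poisson_mod c r s).
Proof.
  intros oD Hu Hr HD (cs & ss & us). split; [|split].
  - intros z Dz. now apply poisson_mod_continuous with D.
  - now apply poisson_mod_superharmonic.
  - intros z Dz. destruct (Rlt_le_dec (sqd c z) (r ^ 2)) as [Hz|Hz];
      [|rewrite poisson_mod_out by exact Hz; now apply us].
    destruct (Hu z Dz) as (l & hl & lu & <-).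
    apply (harmonic_maximum c r (poisson_mod c r s) l); trivial.
    + intros w Hw. apply poisson_mod_continuous with D; auto.
    + intros w Hw. apply harmonic_continuous with D; auto.
    + apply harmonic_poisson_mod. auto.
    + apply harmonic_subset with D; [|exact hl]. intros w Hw. apply HD. lra.
    + intros w Hw. rewrite poisson_mod_out by lra.
      assert (D w) by (apply HD; lra). apply Rle_trans with (u w); auto.
    + lra.
Qed.

Lemma continuous_Rmin {T : UniformSpace} (f g : T -> R) z :
  continuous f z -> continuous g z -> continuous (fun w => Rmin (f w) (g w)) z.
Proof.
  intros cf cg.
  apply continuous_ext with (fun w => / 2 * (f w + g w - Rabs (f w - g w))).
  - intros w. unfold Rmin. destruct Rle_dec; [rewrite Rabs_left1|rewrite Rabs_right]; lra.
  - apply continuous_Rmult; [apply continuous_const|]. apply continuous_Rminus; [now apply continuous_Rplus|].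
    apply (continuous_comp (fun w => f w - g w) Rabs); [now apply continuous_Rminus|apply continuous_Rabs].
Qed.

Lemma perron_min D u s t : perron D u s -> perron D u t -> perron D u (fun z => Rmin (s z) (t z)).
Proof.
  intros (cs & ss & us) (ct & st & ut). split; [|split].
  - intros z Dz. apply continuous_Rmin; auto.
  - now apply superharmonic_min.
  - intros z Dz. apply Rmin_glb; auto.
Qed.

Lemma perron_infimum D u s0 : perron D u s0 ->
  exists w, forall z, D z -> (forall s, perron D u s -> w z <= s z) /\
    forall eps, 0 < eps -> exists s, perron D u s /\ s z < w z + eps.
Proof.
  intros H0.
  assert (H : forall z, exists y, D z -> (forall s, perron D u s -> y <= s z) /\
    forall eps, 0 < eps -> exists s, perron D u s /\ s z < y + eps).
  { intros z. destruct (classic (D z)) as [Dz|]; [|now exists 0].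
    destruct (completeness (fun y => exists s, perron D u s /\ y = - s z)) as [m [Hub Hlub]].
    - exists (- u z). intros y (s & (_ & _ & Hs) & ->). specialize (Hs z Dz). lra.
    - now exists (- s0 z), s0.
    - exists (- m). intros _. split.
      + intros s Hs. assert (- s z <= m) by (apply Hub; now exists s). lra.
      + intros eps He. apply NNPP. intros Hno.
        assert (m <= m - eps); [|lra]. apply Hlub. intros y (s & Hs & ->).
        apply Rnot_lt_le. intros Hlt. apply Hno. exists s. split; [exact Hs|lra]. }
  exists (fun z => proj1_sig (constructive_indefinite_description _ (H z))).
  intros z. exact (proj2_sig (constructive_indefinite_description _ (H z))).
Qed.

Lemma poisson_mod_harnack D c r s m z : open D -> 0 < r ->
  (forall w, sqd c w <= r ^ 2 -> D w) ->
  (forall w, D w -> continuous s w) -> (forall w, D w -> continuous m w) ->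
  (forall w, D w -> m w <= s w) -> 4 * sqd c z <= r ^ 2 ->
  poisson_mod c r s z - poisson_mod c r m z <= 3 * (poisson_mod c r s c - poisson_mod c r m c).
Proof.
  intros oD Hr HD cs cm Hle Hz.
  assert (Hz' : sqd c z < r ^ 2) by (pose proof (sqd_pos c z); nra).
  assert (Hc : sqd c c < r ^ 2) by (rewrite sqd_refl; nra).
  assert (Cs : forall t, continuous (fun t => s (circle c r t)) t) by (apply continuous_on_circle; auto).
  assert (Cm : forall t, continuous (fun t => m (circle c r t)) t) by (apply continuous_on_circle; auto).
  rewrite !poisson_mod_in by assumption. rewrite <- !poisson_minus by assumption.
  apply poisson_harnack; trivial.
  - intros t. now apply continuous_Rminus.
  - intros t. assert (m (circle c r t) <= s (circle c r t)); [|lra].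
    apply Hle, HD. rewrite sqd_center_circle. lra.
Qed.

(* A near-minimiser at the center, replaced by its Poisson integral, is uniformly near-minimal on the
   half disc: compare with the minimum with any other member and apply Harnack's inequality. *)
Lemma perron_approx D u w c r eps : open D -> max_of_harmonics D u -> 0 < r ->
  (forall z, sqd c z <= r ^ 2 -> D z) ->
  (forall z, D z -> (forall s, perron D u s -> w z <= s z) /\
    forall eps, 0 < eps -> exists s, perron D u s /\ s z < w z + eps) ->
  0 < eps ->
  exists h, harmonic (fun z => sqd c z < r ^ 2) h /\
    forall z, 4 * sqd c z <= r ^ 2 -> Rabs (h z - w z) <= eps.
Proof.
  intros oD Hu Hr HD Hw He.
  assert (Dc : D c) by (apply HD; rewrite sqd_refl; nra).
  (* Harnack triples the gap at the center to [eps / 2]; the competitor [t] chosen at [z] costs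
     another [eps / 2]. *)
  destruct (proj2 (Hw c Dc) (eps / 6) ltac:(lra)) as (s & Hs & Hsc).
  pose proof Hs as (cs & ss & us).
  exists (poisson_mod c r s). split; [apply harmonic_poisson_mod; auto|].
  intros z Hz.
  assert (Hz' : sqd c z < r ^ 2) by (pose proof (sqd_pos c z); nra).
  assert (Dz : D z) by (apply HD; lra).
  assert (w z <= poisson_mod c r s z) by now apply (proj1 (Hw z Dz)), poisson_mod_perron.
  destruct (proj2 (Hw z Dz) (eps / 2) ltac:(lra)) as (t & Ht & Htz).
  assert (Hm := perron_min D u s t Hs Ht).
  set (m := fun z => Rmin (s z) (t z)) in *. pose proof Hm as (cm & sm & um).
  assert (H3 : poisson_mod c r s z - poisson_mod c r m z <= 3 * (poisson_mod c r s c - poisson_mod c r m c)).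
  { apply poisson_mod_harnack with D; trivial. intros x _. apply Rmin_l. }
  assert (poisson_mod c r m z <= m z) by now apply poisson_mod_le with D.
  assert (m z <= t z) by apply Rmin_r.
  assert (poisson_mod c r s c <= s c) by now apply poisson_mod_le with D.
  assert (w c <= poisson_mod c r m c) by now apply (proj1 (Hw c Dc)), poisson_mod_perron.
  apply Rabs_le. lra.
Qed.

(** On the half disc [w] is a uniform limit of continuous functions, hence continuous, so it has a
    Poisson integral [P] on the smaller disc of radius [r / 4]. An approximant [h] is within [eps]
    of [w], and by the maximum principle within [eps] of [P]; so [P] and [w] agree. *)
Lemma harmonic_of_uniform_approx c r w : 0 < r ->
  (forall eps, 0 < eps -> exists h, harmonic (fun z => sqd c z < r ^ 2) h /\
    forall z, 4 * sqd c z <= r ^ 2 -> Rabs (h z - w z) <= eps) ->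
  harmonic (fun z => sqd c z < (r / 4) ^ 2) w.
Proof.
  intros Hr H.
  set (E := fun z => sqd c z < (r / 2) ^ 2).
  assert (oE : open E) by apply open_disc.
  assert (E4 : forall z, E z -> 4 * sqd c z <= r ^ 2) by (unfold E; intros z Hz; nra).
  assert (ED : forall z, E z -> sqd c z < r ^ 2) by (unfold E; intros z Hz; nra).
  assert (cw : forall z, E z -> continuous w z).
  { intros z Ez. apply filterlim_locally. intros eps.
    destruct (H (eps / 4)) as (h & hh & Hh); [pose proof (cond_pos eps); lra|].
    assert (ch : continuous h z).
    { apply (harmonic_continuous (fun z => sqd c z < r ^ 2)); [apply open_disc|exact hh|now apply ED]. }
    assert (He4 : 0 < eps / 4) by (pose proof (cond_pos eps); lra).
    assert (L := proj1 (filterlim_locally _ _) ch (mkposreal _ He4)).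
    generalize (filter_and _ _ L (oE z Ez)). apply filter_imp. intros x [Hx Ex].
    change (Rabs (h x - h z) < eps / 4) in Hx. change (Rabs (w x - w z) < eps).
    pose proof (Hh x (E4 x Ex)) as A. pose proof (Hh z (E4 z Ez)) as B.
    apply Rabs_le_between in A. apply Rabs_le_between in B. apply Rabs_def2 in Hx.
    apply Rabs_def1; lra. }
  set (rho := r / 4). assert (Hrho : 0 < rho) by (unfold rho; lra).
  assert (Hin : forall z, sqd c z <= rho ^ 2 -> E z) by (unfold E, rho; intros z Hz; nra).
  set (P := poisson_mod c rho w).
  assert (hP : harmonic (fun z => sqd c z < rho ^ 2) P) by (apply harmonic_poisson_mod; auto).
  assert (cP : forall z, sqd c z <= rho ^ 2 -> continuous P z).
  { intros z Hz. apply poisson_mod_continuous with E; auto. }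
  apply harmonic_ext with P; [apply open_disc| |exact hP].
  intros z Hz. apply Rle_antisym; apply Rnot_lt_le; intros Hlt.
  (* A quarter, because the comparison yields [|P z - w z| <= 2 eps]. The shifts of [h] by constants
     are phrased as affine functions to be harmonic by [harmonic_affine]. *)
  all: pose (eps := Rabs (P z - w z) / 4);
    assert (He : 0 < eps) by (apply Rdiv_lt_0_compat; [apply Rabs_pos_lt; lra|lra]);
    destruct (H eps He) as (h & hh & Hh);
    assert (ch : forall z, sqd c z <= rho ^ 2 -> continuous h z) by
      (intros x Hx; apply (harmonic_continuous (fun z => sqd c z < r ^ 2)); [apply open_disc|exact hh|auto]);
    assert (hk : forall k : R, harmonic (fun z => sqd c z < rho ^ 2) (fun x => 1 * h x + 1 * (k + 0 * Re x + 0 * Im x))) by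
      (intros k; apply harmonic_lin; [apply open_disc|
         apply harmonic_subset with (2 := hh); intros x Hx; apply ED, Hin; lra|apply harmonic_affine, open_disc]);
    assert (ck : forall (k : R) x, sqd c x <= rho ^ 2 -> continuous (fun x => 1 * h x + 1 * (k + 0 * Re x + 0 * Im x)) x) by
      (intros k x Hx; apply continuous_lin; [auto|];
       apply (harmonic_continuous (fun _ => True)); [apply open_true|apply harmonic_affine, open_true|trivial]);
    assert (Hzh := Hh z (E4 z (Hin z ltac:(lra)))); apply Rabs_le_between in Hzh.
  - assert (P z <= 1 * h z + 1 * (eps + 0 * Re z + 0 * Im z)).
    { apply (harmonic_maximum c rho (fun x => 1 * h x + 1 * (eps + 0 * Re x + 0 * Im x)) P); auto; [|lra].
      intros x Hx. unfold P. rewrite poisson_mod_out by lra.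
      assert (Hxh := Hh x (E4 x (Hin x ltac:(lra)))). apply Rabs_le_between in Hxh. lra. }
    unfold eps in *. rewrite Rabs_right in * by lra. lra.
  - assert (1 * h z + 1 * (- eps + 0 * Re z + 0 * Im z) <= P z).
    { apply (harmonic_maximum c rho P (fun x => 1 * h x + 1 * (- eps + 0 * Re x + 0 * Im x))); auto; [|lra].
      intros x Hx. unfold P. rewrite poisson_mod_out by lra.
      assert (Hxh := Hh x (E4 x (Hin x ltac:(lra)))). apply Rabs_le_between in Hxh. lra. }
    unfold eps in *. rewrite Rabs_left in * by lra. lra.
Qed.

Lemma open_contains_closed_disc (D : C -> Prop) (c : C) : open D -> D c ->
  exists r, 0 < r /\ forall z, sqd c z <= r ^ 2 -> D z.
Proof.
  intros oD Dc. destruct (oD c Dc) as [d Hd]. pose proof (cond_pos d).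
  exists (d / 2). split; [lra|]. intros z Hz. apply NNPP. intros Hn.
  assert (Hb : ~ ball c d z) by (intros Hb; now apply Hn, Hd).
  apply far_from_ball_sqd in Hb. nra.
Qed.

Lemma least_harmonic_majorant_exists D u k : open D -> max_of_harmonics D u ->
  harmonic_majorant D u k -> exists h, is_least_harmonic_majorant D u h.
Proof.
  intros oD Hu Hk.
  assert (HP : forall k, harmonic_majorant D u k -> perron D u k).
  { intros k' (hk & uk). split; [|split]; trivial.
    - intros z Dz. now apply harmonic_continuous with D.
    - now apply harmonic_superharmonic. }
  destruct (perron_infimum D u k (HP k Hk)) as [w Hw].
  exists w. split; [split|].
  - apply harmonic_local. intros c Dc.
    destruct (open_contains_closed_disc D c oD Dc) as (r & Hr & HD).
    exists (fun z => sqd c z < (r / 4) ^ 2). split; [rewrite sqd_refl; nra|].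
    apply harmonic_of_uniform_approx; [exact Hr|].
    intros eps He. now apply perron_approx with D u.
  - intros z Dz. apply Rnot_lt_le. intros Hlt.
    destruct (proj2 (Hw z Dz) (u z - w z) ltac:(lra)) as (s & (_ & _ & us) & Hs).
    specialize (us z Dz). lra.
  - intros k' Hk' z Dz. apply (proj1 (Hw z Dz)). now apply HP.
Qed.

(** * Powers of an analytic function *)

(* [Re (e^(-i al) (u + i v)^q)] on the right half-plane [u > 0]. *)
Definition re_pow (q al u v : R) : R :=
  exp (q / 2 * ln (u ^ 2 + v ^ 2)) * cos (q * atan (v / u) - al).

Lemma sqr_sum_pos u v : 0 < u -> 0 < u ^ 2 + v ^ 2.
Proof. intros H. pose proof (pow2_ge_0 v). nra. Qed.

Lemma sqrt_polar u v : 0 < u -> sqrt (1 + (v / u) ^ 2) = exp (/ 2 * ln (u ^ 2 + v ^ 2)) / u.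
Proof.
  intros Hu. pose proof (sqr_sum_pos u v Hu) as Hn.
  apply sqrt_lem_1.
  - pose proof (pow2_ge_0 (v / u)). lra.
  - apply Rlt_le, Rdiv_lt_0_compat; [apply exp_pos|exact Hu].
  - replace (exp (/ 2 * ln (u ^ 2 + v ^ 2)) / u * (exp (/ 2 * ln (u ^ 2 + v ^ 2)) / u))
      with (exp (/ 2 * ln (u ^ 2 + v ^ 2)) * exp (/ 2 * ln (u ^ 2 + v ^ 2)) / (u * u)) by (field; lra).
    rewrite <- exp_plus. replace (/ 2 * ln (u ^ 2 + v ^ 2) + / 2 * ln (u ^ 2 + v ^ 2)) with (ln (u ^ 2 + v ^ 2)) by field.
    rewrite exp_ln by exact Hn. field. lra.
Qed.

Lemma polar_cos u v : 0 < u -> exp (/ 2 * ln (u ^ 2 + v ^ 2)) * cos (atan (v / u)) = u.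
Proof.
  intros Hu. rewrite cos_atan. unfold Rsqr.
  replace (1 + v / u * (v / u)) with (1 + (v / u) ^ 2) by ring. rewrite sqrt_polar by exact Hu.
  pose proof (exp_pos (/ 2 * ln (u ^ 2 + v ^ 2))). field. lra.
Qed.

Lemma polar_sin u v : 0 < u -> exp (/ 2 * ln (u ^ 2 + v ^ 2)) * sin (atan (v / u)) = v.
Proof.
  intros Hu. rewrite sin_atan. unfold Rsqr.
  replace (1 + v / u * (v / u)) with (1 + (v / u) ^ 2) by ring. rewrite sqrt_polar by exact Hu.
  pose proof (exp_pos (/ 2 * ln (u ^ 2 + v ^ 2))). field. lra.
Qed.

Lemma exp_pow_step q u v : 0 < u ->
  exp ((q - 1) / 2 * ln (u ^ 2 + v ^ 2)) =
  exp (q / 2 * ln (u ^ 2 + v ^ 2)) * exp (/ 2 * ln (u ^ 2 + v ^ 2)) / (u ^ 2 + v ^ 2).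
Proof.
  intros Hu. pose proof (sqr_sum_pos u v Hu) as Hn.
  apply Rmult_eq_reg_r with (u ^ 2 + v ^ 2); [|lra].
  replace (exp (q / 2 * ln (u ^ 2 + v ^ 2)) * exp (/ 2 * ln (u ^ 2 + v ^ 2)) / (u ^ 2 + v ^ 2) * (u ^ 2 + v ^ 2))
    with (exp (q / 2 * ln (u ^ 2 + v ^ 2)) * exp (/ 2 * ln (u ^ 2 + v ^ 2))) by (field; lra).
  rewrite <- (exp_ln (u ^ 2 + v ^ 2) Hn) at 2. rewrite <- !exp_plus. f_equal. field.
Qed.

(** This is [F^(q - 1) = F^q conj(F) / |F|^2] with [F = u + i v], in real parts. *)
Lemma re_pow_lower q al u v : 0 < u ->
  re_pow (q - 1) al u v = exp (q / 2 * ln (u ^ 2 + v ^ 2)) / (u ^ 2 + v ^ 2) *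
    (u * cos (q * atan (v / u) - al) + v * sin (q * atan (v / u) - al)).
Proof.
  intros Hu. pose proof (sqr_sum_pos u v Hu) as Hn.
  unfold re_pow. rewrite exp_pow_step by exact Hu.
  replace ((q - 1) * atan (v / u) - al) with ((q * atan (v / u) - al) - atan (v / u)) by ring.
  rewrite cos_minus.
  transitivity (exp (q / 2 * ln (u ^ 2 + v ^ 2)) / (u ^ 2 + v ^ 2) *
    (exp (/ 2 * ln (u ^ 2 + v ^ 2)) * cos (atan (v / u)) * cos (q * atan (v / u) - al) +
     exp (/ 2 * ln (u ^ 2 + v ^ 2)) * sin (atan (v / u)) * sin (q * atan (v / u) - al))).
  - field. lra.
  - rewrite polar_cos, polar_sin by exact Hu. reflexivity.
Qed.

(** The chain rule [(F^q)' = q F^(q - 1) (a' + i b')]. Multiplication by [i] is the shift of [al] by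
    [- PI / 2], so the family [re_pow] is closed under differentiation without complex numbers. *)
Lemma is_derive_re_pow q al (a b : R -> R) x a' b' :
  is_derive a x a' -> is_derive b x b' -> 0 < a x ->
  is_derive (fun t => re_pow q al (a t) (b t)) x
    (q * (re_pow (q - 1) al (a x) (b x) * a' + re_pow (q - 1) (al - PI / 2) (a x) (b x) * b')).
Proof.
  intros Ha Hb Hpos. pose proof (sqr_sum_pos (a x) (b x) Hpos) as Hn.
  rewrite !re_pow_lower by exact Hpos. unfold re_pow.
  replace (q * atan (b x / a x) - (al - PI / 2)) with ((q * atan (b x / a x) - al) + PI / 2) by ring.
  rewrite cos_plus, sin_plus, cos_PI2, sin_PI2.
  auto_derive.
  - repeat split; try (now exists a'); try (now exists b'); lra.
  - replace (Derive (fun x : R => a x) x) with a' by (symmetry; exact (is_derive_unique _ _ _ Ha)).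
    replace (Derive (fun x : R => b x) x) with b' by (symmetry; exact (is_derive_unique _ _ _ Hb)).
    cbn [pow] in *. unfold Rdiv, Rminus.
    generalize (exp (q * / 2 * ln (a x * (a x * 1) + b x * (b x * 1)))) as E.
    generalize (cos (q * atan (b x * / a x) + - al)) as c0.
    generalize (sin (q * atan (b x * / a x) + - al)) as s0.
    intros s0 c0 E. field. split; intros E0; nra.
Qed.

Lemma has_partials_re_pow q al (U V Ux Uy Vx Vy : C -> R) z :
  has_partials U Ux Uy z -> has_partials V Vx Vy z -> 0 < U z ->
  has_partials (fun w => re_pow q al (U w) (V w))
    (fun w => q * (re_pow (q - 1) al (U w) (V w) * Ux w) + q * (re_pow (q - 1) (al - PI / 2) (U w) (V w) * Vx w))
    (fun w => q * (re_pow (q - 1) al (U w) (V w) * Uy w) + q * (re_pow (q - 1) (al - PI / 2) (U w) (V w) * Vy w)) z.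
Proof.
  intros [U1 U2] [V1 V2] Hp. destruct z as [x y]. cbn [Re Im fst snd] in *.
  split; rewrite <- Rmult_plus_distr_l.
  - exact (is_derive_re_pow q al (fun t => U (t, y)) (fun t => V (t, y)) x _ _ U1 V1 Hp).
  - exact (is_derive_re_pow q al (fun t => U (x, t)) (fun t => V (x, t)) y _ _ U2 V2 Hp).
Qed.

Lemma continuous_re_pow q al (U V : C -> R) z :
  continuous U z -> continuous V z -> 0 < U z -> continuous (fun w => re_pow q al (U w) (V w)) z.
Proof.
  intros cU cV Hp. pose proof (sqr_sum_pos (U z) (V z) Hp) as Hn. apply continuous_Rmult.
  - apply (continuous_derivable (fun n => exp (q / 2 * ln n)) (fun w => U w ^ 2 + V w ^ 2)).
    + auto_derive. exact Hn.
    + apply continuous_Rplus.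
      * apply (continuous_derivable (fun x => x ^ 2) U); [auto_derive; trivial|exact cU].
      * apply (continuous_derivable (fun x => x ^ 2) V); [auto_derive; trivial|exact cV].
  - apply (continuous_derivable (fun x => cos (q * atan x - al)) (fun w => V w / U w)).
    + auto_derive. trivial.
    + apply continuous_Rmult; [exact cV|].
      apply (continuous_derivable Rinv U); [auto_derive; lra|exact cU].
Qed.

Lemma re_pow_shift_PI q al u v : re_pow q (al - PI / 2 - PI / 2) u v = - re_pow q al u v.
Proof.
  unfold re_pow. replace (q * atan (v / u) - (al - PI / 2 - PI / 2)) with (q * atan (v / u) - al + PI) by field.
  rewrite neg_cos. ring.
Qed.

Definition cauchy_riemann (D : C -> Prop) (U V : C -> R) : Prop :=
  forall z, D z -> dx U z = dy V z /\ dy U z = - dx V z.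

Lemma harmonic_re_pow D q al (U V : C -> R) :
  open D -> (forall z, D z -> 0 < U z) -> harmonic D U -> harmonic D V -> cauchy_riemann D U V ->
  harmonic D (fun z => re_pow q al (U z) (V z)).
Proof.
  intros oD HU hU hV CR.
  assert (cU : forall z, D z -> continuous U z) by (intros z Dz; now apply harmonic_continuous with D).
  assert (cV : forall z, D z -> continuous V z) by (intros z Dz; now apply harmonic_continuous with D).
  destruct hU as [(U1 & U2 & U3) LU]. destruct hV as [(V1 & V2 & V3) LV].
  assert (cG : forall q al z, D z -> continuous (fun w => re_pow q al (U w) (V w)) z).
  { intros q' al' z Dz. apply continuous_re_pow; auto. }
  pose proof (fun q' al' z Dz => has_partials_re_pow q' al' U V _ _ _ _ z
    (C1_on_partials D U z U1 Dz) (C1_on_partials D V z V1 Dz) (HU z Dz)) as pG.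
  assert (cp : forall q a b c d z, continuous a z -> continuous b z -> continuous c z -> continuous d z ->
     continuous (fun w : C => q * (a w * b w) + q * (c w * d w)) z).
  { intros q' a b c d z ca cb cc cd. apply continuous_lin; now apply continuous_Rmult. }
  eapply harmonic_intro; [exact oD|intros z Dz; exact (pG q al z Dz)| | | | | | | | | ].
  - intros z Dz. apply has_partials_lin.
    + exact (has_partials_mult _ _ _ _ _ _ z (pG (q - 1) al z Dz) (C1_on_partials D _ z U2 Dz)).
    + exact (has_partials_mult _ _ _ _ _ _ z (pG (q - 1) (al - PI / 2) z Dz) (C1_on_partials D _ z V2 Dz)).
  - intros z Dz. apply has_partials_lin.
    + exact (has_partials_mult _ _ _ _ _ _ z (pG (q - 1) al z Dz) (C1_on_partials D _ z U3 Dz)).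
    + exact (has_partials_mult _ _ _ _ _ _ z (pG (q - 1) (al - PI / 2) z Dz) (C1_on_partials D _ z V3 Dz)).
  - intros z Dz. apply cp; auto; [exact (C1_on_continuous_dx D U z U1 Dz)|exact (C1_on_continuous_dx D V z V1 Dz)].
  - intros z Dz. apply cp; auto; [exact (C1_on_continuous_dy D U z U1 Dz)|exact (C1_on_continuous_dy D V z V1 Dz)].
  - intros z Dz. apply continuous_lin; apply continuous_Rplus; apply continuous_Rmult; auto; try (apply cp; auto);
    first [exact (C1_on_continuous_dx D U z U1 Dz)|exact (C1_on_continuous_dx D V z V1 Dz)
      |exact (C1_on_continuous_dx D _ z U2 Dz)|exact (C1_on_continuous_dx D _ z V2 Dz)].
  - intros z Dz. apply continuous_lin; apply continuous_Rplus; apply continuous_Rmult; auto; try (apply cp; auto);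
    first [exact (C1_on_continuous_dx D U z U1 Dz)|exact (C1_on_continuous_dx D V z V1 Dz)
      |exact (C1_on_continuous_dy D U z U1 Dz)|exact (C1_on_continuous_dy D V z V1 Dz)
      |exact (C1_on_continuous_dy D _ z U2 Dz)|exact (C1_on_continuous_dy D _ z V2 Dz)].
  - intros z Dz. apply continuous_lin; apply continuous_Rplus; apply continuous_Rmult; auto; try (apply cp; auto);
    first [exact (C1_on_continuous_dx D U z U1 Dz)|exact (C1_on_continuous_dx D V z V1 Dz)
      |exact (C1_on_continuous_dy D U z U1 Dz)|exact (C1_on_continuous_dy D V z V1 Dz)
      |exact (C1_on_continuous_dx D _ z U3 Dz)|exact (C1_on_continuous_dx D _ z V3 Dz)].
  - intros z Dz. apply continuous_lin; apply continuous_Rplus; apply continuous_Rmult; auto; try (apply cp; auto);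
    first [exact (C1_on_continuous_dy D U z U1 Dz)|exact (C1_on_continuous_dy D V z V1 Dz)
      |exact (C1_on_continuous_dy D _ z U3 Dz)|exact (C1_on_continuous_dy D _ z V3 Dz)].
  (* The Cauchy-Riemann equations say [F_y = i F_x], which cancels the terms in [F^(q - 2)]; those
     in [F^(q - 1)] vanish because [U] and [V] are harmonic. *)
  - intros z Dz. cbn beta. rewrite re_pow_shift_PI.
    specialize (LU z Dz). specialize (LV z Dz). destruct (CR z Dz) as [C1 C2].
    replace (dy (dy U) z) with (- dx (dx U) z) by lra.
    replace (dy (dy V) z) with (- dx (dx V) z) by lra.
    rewrite C2, C1. ring.
Qed.

(** * Cauchy-Riemann equations and trigonometric inequalities *)

Lemma is_derive_of_bound (f : R -> R) (x l : R) :
  (forall eps : posreal, exists d : posreal, forall h, Rabs h < d ->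
     Rabs (f (x + h) - f x - h * l) <= eps * Rabs h) -> is_derive f x l.
Proof.
  intros H. apply is_derive_Reals. intros eps He.
  assert (He2 : 0 < eps / 2) by lra.
  destruct (H (mkposreal _ He2)) as [d Hd]. exists d. intros h Hh0 Hh.
  specialize (Hd h Hh). cbn in Hd.
  replace ((f (x + h) - f x) / h - l) with ((f (x + h) - f x - h * l) / h) by (field; exact Hh0).
  assert (0 < Rabs h) by now apply Rabs_pos_lt.
  unfold Rdiv. rewrite Rabs_mult, Rabs_inv. apply Rmult_lt_reg_r with (Rabs h); [assumption|].
  rewrite Rmult_assoc, Rinv_l, Rmult_1_r by lra. nra.
Qed.

Lemma Rabs_Re_le (z : C) : Rabs (Re z) <= Cmod z.
Proof. apply Rle_trans with (2 := Rmax_Cmod z). apply Rmax_l. Qed.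

Lemma Rabs_Im_le (z : C) : Rabs (Im z) <= Cmod z.
Proof. apply Rle_trans with (2 := Rmax_Cmod z). apply Rmax_r. Qed.

(** Neighbourhoods in [is_derive] over [C_AbsRing] are those of [Cmod], unlike the square balls used
    for real partials; this form makes the two comparable. *)
Lemma complex_derive_bound (F : C -> C) (z l : C) :
  @is_derive C_AbsRing C_NormedModule F z l ->
  forall eps : posreal, exists d : posreal, forall e : C, Cmod e < d ->
    Cmod (F (z + e)%C - F z - e * l)%C <= eps * Cmod e.
Proof.
  intros [_ H] eps. specialize (H z (fun P HP => HP) eps).
  destruct H as [d Hd]. exists d. intros e He.
  specialize (Hd (z + e)%C).
  replace (Cmod e) with (norm (minus (z + e)%C z)) by
    (change (Cmod (z + e - z)%C = Cmod e); f_equal; ring).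
  apply Rle_trans with (2 := Hd ltac:(change (Cmod (z + e - z)%C < d); replace (z + e - z)%C with e by ring; exact He)).
  right. change (Cmod (F (z + e)%C - F z - e * l)%C = Cmod (F (z + e)%C - F z - (z + e - z) * l)%C).
  f_equal. ring.
Qed.

(** For the derivative [a + i b], a real increment [h] gives the x-partials and the increment [i h]
    the y-partials. *)
Lemma complex_derivable_cauchy_riemann (F : C -> C) (z : C) :
  @ex_derive C_AbsRing C_NormedModule F z ->
  exists a b, has_partials (fun w => Re (F w)) (fun _ => a) (fun _ => - b) z /\
    has_partials (fun w => Im (F w)) (fun _ => b) (fun _ => a) z.
Proof.
  intros [[a b] H]. exists a, b. pose proof (complex_derive_bound F z _ H) as HB.
  assert (Hh : forall eps : posreal, exists d : posreal, forall h, Rabs h < d ->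
    Cmod (F ((Re z + h)%R, Im z) - F z - (RtoC h) * (a, b))%C <= eps * Rabs h).
  { intros eps. destruct (HB eps) as [d Hd]. exists d. intros h Hh0.
    specialize (Hd (RtoC h)). rewrite Cmod_R in Hd. specialize (Hd Hh0).
    replace (z + RtoC h)%C with (Re z + h, Im z) in Hd; [exact Hd|].
    rewrite (C_eta z) at 3. unfold Cplus, RtoC. cbn. f_equal; ring. }
  assert (Hv : forall eps : posreal, exists d : posreal, forall h, Rabs h < d ->
    Cmod (F (Re z, (Im z + h)%R) - F z - (Ci * RtoC h) * (a, b))%C <= eps * Rabs h).
  { intros eps. destruct (HB eps) as [d Hd]. exists d. intros h Hh0.
    specialize (Hd (Ci * RtoC h)%C). rewrite Cmod_mult, Cmod_Ci, Rmult_1_l, Cmod_R in Hd. specialize (Hd Hh0).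
    replace (z + Ci * RtoC h)%C with (Re z, Im z + h) in Hd; [exact Hd|].
    rewrite (C_eta z) at 3. unfold Cplus, Cmult, Ci, RtoC. cbn. f_equal; ring. }
  split; split; apply is_derive_of_bound; intros eps.
  - destruct (Hh eps) as [d Hd]. exists d. intros h Hlt. apply Rle_trans with (2 := Hd h Hlt).
    apply Rle_trans with (2 := Rabs_Re_le _). right. f_equal. rewrite <- C_eta. unfold Re, Im. cbn. ring.
  - destruct (Hv eps) as [d Hd]. exists d. intros h Hlt. apply Rle_trans with (2 := Hd h Hlt).
    apply Rle_trans with (2 := Rabs_Re_le _). right. f_equal. rewrite <- C_eta. unfold Re, Im. cbn. ring.
  - destruct (Hh eps) as [d Hd]. exists d. intros h Hlt. apply Rle_trans with (2 := Hd h Hlt).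
    apply Rle_trans with (2 := Rabs_Im_le _). right. f_equal. rewrite <- C_eta. unfold Re, Im. cbn. ring.
  - destruct (Hv eps) as [d Hd]. exists d. intros h Hlt. apply Rle_trans with (2 := Hd h Hlt).
    apply Rle_trans with (2 := Rabs_Im_le _). right. f_equal. rewrite <- C_eta. unfold Re, Im. cbn. ring.
Qed.

Lemma with_conjugate_eq U V z : with_conjugate U V z = (U z, V z).
Proof. unfold with_conjugate, Cplus, Cmult, Ci, RtoC. cbn. f_equal; ring. Qed.

Lemma analytic_cauchy_riemann D U V : analytic D (with_conjugate U V) -> cauchy_riemann D U V.
Proof.
  intros H z Dz. destruct (complex_derivable_cauchy_riemann _ _ (H z Dz)) as (a & b & H1 & H2).
  assert (E1 : (fun w => Re (with_conjugate U V w)) = U).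
  { apply functional_extensionality. intros w. now rewrite with_conjugate_eq. }
  assert (E2 : (fun w => Im (with_conjugate U V w)) = V).
  { apply functional_extensionality. intros w. now rewrite with_conjugate_eq. }
  rewrite E1 in H1. rewrite E2 in H2.
  rewrite (has_partials_dx _ _ _ _ H1), (has_partials_dy _ _ _ _ H1).
  rewrite (has_partials_dx _ _ _ _ H2), (has_partials_dy _ _ _ _ H2). now split.
Qed.

(** * Monotone trigonometric quotients and tangent lines of powers *)

Lemma mvt_derive (f f' : R -> R) a b : a < b ->
  (forall t, a <= t <= b -> is_derive f t (f' t)) ->
  exists t, f b - f a = f' t * (b - a) /\ a < t < b.
Proof. intros Hab H. apply (MVT_cor2 f f' a b Hab). intros t Ht. now apply is_derive_Reals, H. Qed.

(** [sin(m t) / sin t] increases: the numerator of its derivative vanishes at [0] and has derivative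
    [(1 - m^2) sin(m t) sin t]. The inequality is cleared of denominators to allow [x = 0]. *)
Lemma sin_ratio m x y : 0 < m < 1 -> 0 <= x <= y -> y <= PI / 2 ->
  sin y * sin (m * x) <= sin x * sin (m * y).
Proof.
  intros Hm Hxy Hy. pose proof PI_RGT_0 as HPI.
  assert (Hsin : forall t, 0 < t <= PI / 2 -> 0 < sin t) by (intros t Ht; apply sin_gt_0; lra).
  assert (Hsinm : forall t, 0 < t <= PI / 2 -> 0 < sin (m * t)) by (intros t Ht; assert (0 < m * t) by (apply Rmult_lt_0_compat; lra);
    assert (0 < (1 - m) * t) by (apply Rmult_lt_0_compat; lra); apply sin_gt_0; lra).
  destruct (Rle_lt_or_eq_dec 0 x (proj1 Hxy)) as [Hx|<-].
  2: { rewrite Rmult_0_r, sin_0. lra. }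
  destruct (Rle_lt_or_eq_dec x y (proj2 Hxy)) as [Hlt|<-]; [|lra].
  assert (HE : forall t, 0 < t <= PI / 2 -> 0 <= m * cos (m * t) * sin t - sin (m * t) * cos t).
  { intros t Ht.
    destruct (mvt_derive (fun t => m * cos (m * t) * sin t - sin (m * t) * cos t)
      (fun t => (1 - m ^ 2) * (sin (m * t) * sin t)) 0 t) as (xi & Heq & Hxi); [lra| |].
    { intros s _. auto_derive; trivial. ring. }
    rewrite Rmult_0_r, sin_0 in Heq.
    assert (0 < sin (m * xi) * sin xi) by (apply Rmult_lt_0_compat; [apply Hsinm|apply Hsin]; lra).
    assert (0 < 1 - m ^ 2) by nra.
    assert (0 < (1 - m ^ 2) * (sin (m * xi) * sin xi) * (t - 0)) by (apply Rmult_lt_0_compat; [now apply Rmult_lt_0_compat|lra]).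
    lra. }
  destruct (mvt_derive (fun t => sin (m * t) / sin t)
    (fun t => (m * cos (m * t) * sin t - sin (m * t) * cos t) / (sin t) ^ 2) x y Hlt) as (xi & Heq & Hxi).
  { intros t Ht. specialize (Hsin t ltac:(lra)). auto_derive; [lra|]. field. lra. }
  assert (0 <= (m * cos (m * xi) * sin xi - sin (m * xi) * cos xi) / sin xi ^ 2 * (y - x)).
  { apply Rmult_le_pos; [|lra]. apply Rdiv_le_0_compat; [apply HE; lra|].
    apply pow_lt, Hsin. lra. }
  assert (sx := Hsin x ltac:(lra)). assert (sy := Hsin y ltac:(lra)).
  assert (Hle : sin (m * x) / sin x <= sin (m * y) / sin y) by lra.
  apply Rmult_le_compat_r with (r := sin x * sin y) in Hle; [|apply Rlt_le; now apply Rmult_lt_0_compat].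
  replace (sin (m * x) / sin x * (sin x * sin y)) with (sin y * sin (m * x)) in Hle by (field; lra).
  replace (sin (m * y) / sin y * (sin x * sin y)) with (sin x * sin (m * y)) in Hle by (field; lra).
  exact Hle.
Qed.

(** One computation for two uses: [A = 1], [T = tan(th)] for the upper bound, and [A = 0], [T = 1]
    for the strips. *)
Lemma is_derive_cos_quotient p A T x : 0 < cos x ->
  is_derive (fun x => (A + T * cos (p * x)) * exp (- p * ln (cos x))) x
    (p * exp (- p * ln (cos x)) / cos x * (A * sin x - T * sin ((p - 1) * x))).
Proof.
  intros Hc. auto_derive; [exact Hc|].
  replace ((p - 1) * x) with (p * x - x) by ring. rewrite sin_minus. field. lra.
Qed.

Lemma cos_pos_lt x : 0 <= x < PI / 2 -> 0 < cos x.
Proof. intros H. apply cos_gt_0; lra. Qed.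

Lemma theta_bounds p : 1 < p < 2 -> PI / 4 < PI / (2 * p) < PI / 2.
Proof.
  intros Hp. pose proof PI_RGT_0. split.
  - apply Rmult_lt_compat_l; [lra|]. apply Rinv_lt_contravar; lra.
  - apply Rmult_lt_compat_l; [lra|]. apply Rinv_lt_contravar; lra.
Qed.

(** The derivative has the sign of [sin t sin((p - 1) th) - sin th sin((p - 1) t)], which by
    [sin_ratio] with [m = p - 1] is nonnegative before [th] and nonpositive after it. *)
Lemma cos_quotient_max p x : 1 < p < 2 -> 0 <= x < PI / 2 ->
  (1 + tan (PI / (2 * p)) * cos (p * x)) * exp (- p * ln (cos x))
    <= exp (- p * ln (cos (PI / (2 * p)))).
Proof.
  intros Hp Hx. destruct (theta_bounds p Hp) as [Ht1 Ht2]. pose proof PI_RGT_0 as HPI.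
  set (th := PI / (2 * p)) in *.
  assert (cth : 0 < cos th) by (apply cos_pos_lt; lra).
  assert (pth : p * th = PI / 2) by (unfold th; field; lra).
  assert (sth : sin ((p - 1) * th) = cos th).
  { replace ((p - 1) * th) with (PI / 2 - th) by lra. apply sin_shift. }
  set (f := fun x => (1 + tan th * cos (p * x)) * exp (- p * ln (cos x))).
  assert (Fth : f th = exp (- p * ln (cos th))).
  { unfold f. rewrite pth, cos_PI2. ring. }
  set (g := fun x => p * exp (- p * ln (cos x)) / cos x * (1 * sin x - tan th * sin ((p - 1) * x))).
  assert (Hd : forall t, 0 <= t < PI / 2 -> is_derive f t (g t)).
  { intros t Ht. apply (is_derive_cos_quotient p 1 (tan th) t). now apply cos_pos_lt. }
  assert (Hpos : forall t, 0 <= t < PI / 2 -> 0 < p * exp (- p * ln (cos t)) / cos t).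
  { intros t Ht. apply Rdiv_lt_0_compat; [|now apply cos_pos_lt].
    apply Rmult_lt_0_compat; [lra|apply exp_pos]. }
  assert (Hsgn : forall t, 1 * sin t - tan th * sin ((p - 1) * t)
     = (sin t * sin ((p - 1) * th) - sin th * sin ((p - 1) * t)) / cos th).
  { intros t. rewrite sth. unfold tan. field. lra. }
  change (f x <= exp (- p * ln (cos th))). rewrite <- Fth.
  destruct (Rtotal_order x th) as [Hlt|[->|Hgt]]; [|lra|].
  - destruct (mvt_derive f g x th Hlt) as (t & Heq & Ht); [intros; apply Hd; lra|].
    assert (0 <= g t * (th - x)); [|lra].
    apply Rmult_le_pos; [|lra]. unfold g. apply Rmult_le_pos; [apply Rlt_le, Hpos; lra|].
    rewrite Hsgn. apply Rdiv_le_0_compat; [|exact cth].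
    pose proof (sin_ratio (p - 1) t th ltac:(lra) ltac:(lra) ltac:(lra)). lra.
  - destruct (mvt_derive f g th x Hgt) as (t & Heq & Ht); [intros; apply Hd; lra|].
    assert (0 <= - g t * (x - th)); [|lra].
    apply Rmult_le_pos; [|lra]. unfold g. rewrite Ropp_mult_distr_r. apply Rmult_le_pos; [apply Rlt_le, Hpos; lra|].
    rewrite Hsgn. unfold Rdiv. rewrite Ropp_mult_distr_l. apply Rdiv_le_0_compat; [|exact cth].
    pose proof (sin_ratio (p - 1) th t ltac:(lra) ltac:(lra) ltac:(lra)). lra.
Qed.

Lemma cos_pow_inequality p x : 1 < p < 2 -> - (PI / 2) < x < PI / 2 ->
  1 <= Rpower (sec (PI / (2 * p))) p * Rpower (cos x) p - tan (PI / (2 * p)) * cos (p * x).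
Proof.
  intros Hp Hx.
  assert (Hx' : 0 <= Rabs x < PI / 2) by (split; [apply Rabs_pos|apply Rabs_def1; lra]).
  assert (E1 : cos (p * Rabs x) = cos (p * x)).
  { unfold Rabs. destruct Rcase_abs; [|reflexivity]. rewrite <- Ropp_mult_distr_r. apply cos_neg. }
  assert (E2 : cos (Rabs x) = cos x).
  { unfold Rabs. destruct Rcase_abs; [|reflexivity]. apply cos_neg. }
  pose proof (cos_quotient_max p (Rabs x) Hp Hx') as H. rewrite E1, E2 in H.
  destruct (theta_bounds p Hp) as [Ht1 Ht2]. pose proof PI_RGT_0 as HPI.
  unfold Rpower, sec. rewrite ln_Rinv by (apply cos_pos_lt; lra).
  replace (p * - ln (cos (PI / (2 * p)))) with (- p * ln (cos (PI / (2 * p)))) by ring.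
  apply Rmult_le_compat_r with (r := exp (p * ln (cos x))) in H; [|apply Rlt_le, exp_pos].
  rewrite Rmult_assoc, <- exp_plus in H.
  replace (- p * ln (cos x) + p * ln (cos x)) with 0 in H by ring. rewrite exp_0 in H. lra.
Qed.

(** The derivative of [cos(p x) / cos(x)^p] is a negative multiple of [sin((p - 1) x)]. On a strip
    the quotient is thus smallest at the edge, which bounds [cos(y)^p] by a multiple of
    [cos(p y)]. *)
Lemma cos_quotient_decreasing p x y : 1 < p < 2 -> 0 <= x <= y -> y < PI / 2 ->
  cos (p * y) * Rpower (cos x) p <= cos (p * x) * Rpower (cos y) p.
Proof.
  intros Hp Hxy Hy. pose proof PI_RGT_0 as HPI.
  destruct (Rle_lt_or_eq_dec x y (proj2 Hxy)) as [Hlt|<-]; [|lra].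
  destruct (mvt_derive (fun x => (0 + 1 * cos (p * x)) * exp (- p * ln (cos x)))
    (fun x => p * exp (- p * ln (cos x)) / cos x * (0 * sin x - 1 * sin ((p - 1) * x))) x y Hlt) as (t & Heq & Ht).
  { intros t Ht. apply is_derive_cos_quotient, cos_pos_lt. lra. }
  assert (0 <= p * exp (- p * ln (cos t)) / cos t * sin ((p - 1) * t) * (y - x)).
  { apply Rmult_le_pos; [|lra]. apply Rmult_le_pos.
    - apply Rlt_le, Rdiv_lt_0_compat; [|apply cos_pos_lt; lra].
      apply Rmult_lt_0_compat; [lra|apply exp_pos].
    - apply sin_ge_0; nra. }
  assert (Hle : cos (p * y) * exp (- p * ln (cos y)) <= cos (p * x) * exp (- p * ln (cos x))) by lra.
  assert (Epow : forall c, exp (- p * ln c) * Rpower c p = 1).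
  { intros c. unfold Rpower. rewrite <- exp_plus. rewrite <- exp_0. f_equal. ring. }
  apply Rmult_le_compat_r with (r := Rpower (cos x) p * Rpower (cos y) p) in Hle.
  2: { apply Rlt_le, Rmult_lt_0_compat; apply exp_pos. }
  replace (cos (p * y) * exp (- p * ln (cos y)) * (Rpower (cos x) p * Rpower (cos y) p))
    with (cos (p * y) * Rpower (cos x) p * (exp (- p * ln (cos y)) * Rpower (cos y) p)) in Hle by ring.
  replace (cos (p * x) * exp (- p * ln (cos x)) * (Rpower (cos x) p * Rpower (cos y) p))
    with (cos (p * x) * Rpower (cos y) p * (exp (- p * ln (cos x)) * Rpower (cos x) p)) in Hle by ring.
  rewrite !Epow in Hle. lra.
Qed.

Lemma Rpower_tangent p a x : 1 < p -> 0 < a -> 0 < x ->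
  Rpower a p + p * Rpower a (p - 1) * (x - a) <= Rpower x p.
Proof.
  intros Hp Ha Hx.
  assert (Hd : forall t, 0 < t -> is_derive (fun t => Rpower t p) t (p * Rpower t (p - 1))).
  { intros t Ht. apply is_derive_Reals, derivable_pt_lim_power, Ht. }
  destruct (Rtotal_order a x) as [Hlt|[->|Hgt]]; [|lra|].
  - destruct (mvt_derive (fun t => Rpower t p) (fun t => p * Rpower t (p - 1)) a x Hlt) as (t & Heq & Ht); [intros; apply Hd; lra|].
    assert (Rpower a (p - 1) <= Rpower t (p - 1)) by (apply Rle_Rpower_l; lra).
    cbn beta in Heq.
    assert (0 <= p * (Rpower t (p - 1) - Rpower a (p - 1)) * (x - a)) by (repeat apply Rmult_le_pos; lra). lra.
  - destruct (mvt_derive (fun t => Rpower t p) (fun t => p * Rpower t (p - 1)) x a Hgt) as (t & Heq & Ht); [intros; apply Hd; lra|].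
    assert (Rpower t (p - 1) <= Rpower a (p - 1)) by (apply Rle_Rpower_l; lra).
    cbn beta in Heq.
    assert (0 <= p * (Rpower a (p - 1) - Rpower t (p - 1)) * (a - x)) by (repeat apply Rmult_le_pos; lra). lra.
Qed.

(** * The norm inequality *)

Lemma rpow_pos_eq x a : 0 < x -> rpow x a = Rpower x a.
Proof. intros H. unfold rpow. destruct Rle_dec; [lra|reflexivity]. Qed.

Lemma rpow_le x y a : 0 < a -> x <= y -> rpow x a <= rpow y a.
Proof.
  intros Ha Hxy. unfold rpow. destruct (Rle_dec x 0), (Rle_dec y 0); try lra.
  - apply Rlt_le, exp_pos.
  - apply Rle_Rpower_l; lra.
Qed.

Lemma Cmod_polar u v : 0 < u -> Cmod (u, v) = exp (/ 2 * ln (u ^ 2 + v ^ 2)).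
Proof.
  intros Hu. pose proof (sqr_sum_pos u v Hu) as Hn. unfold Cmod. cbn [fst snd].
  apply sqrt_lem_1; [lra|apply Rlt_le, exp_pos|].
  rewrite <- exp_plus. replace (/ 2 * ln (u ^ 2 + v ^ 2) + / 2 * ln (u ^ 2 + v ^ 2)) with (ln (u ^ 2 + v ^ 2)) by field.
  now apply exp_ln.
Qed.

Lemma mod_pow_with_conjugate p U V z : 0 < U z ->
  mod_pow p (with_conjugate U V) z = exp (p / 2 * ln (U z ^ 2 + V z ^ 2)).
Proof.
  intros Hu. unfold mod_pow. rewrite with_conjugate_eq, Cmod_polar by exact Hu.
  rewrite rpow_pos_eq by apply exp_pos. unfold Rpower. rewrite ln_exp. f_equal. field.
Qed.

Lemma mod_pow_complexify p U z : 0 < U z -> mod_pow p (complexify U) z = Rpower (U z) p.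
Proof.
  intros Hu. unfold mod_pow, complexify. rewrite Cmod_R, Rabs_right by lra. now apply rpow_pos_eq.
Qed.

Lemma Rpower_polar p u v : 0 < u ->
  Rpower u p = exp (p / 2 * ln (u ^ 2 + v ^ 2)) * Rpower (cos (atan (v / u))) p.
Proof.
  intros Hu. destruct (atan_bound (v / u)) as [B1 B2].
  rewrite <- (polar_cos u v Hu) at 1. rewrite <- Rpower_mult_distr by (apply exp_pos || (apply cos_gt_0; lra)).
  f_equal. unfold Rpower. rewrite ln_exp. f_equal. field.
Qed.

Lemma mod_pow_with_conjugate_le p U V z : 1 < p < 2 -> 0 < U z ->
  mod_pow p (with_conjugate U V) z <=
  Rpower (sec (PI / (2 * p))) p * mod_pow p (complexify U) z
    - tan (PI / (2 * p)) * re_pow p 0 (U z) (V z).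
Proof.
  intros Hp Hu. rewrite mod_pow_with_conjugate, mod_pow_complexify by exact Hu.
  rewrite (Rpower_polar p (U z) (V z) Hu). unfold re_pow. rewrite Rminus_0_r.
  set (E := exp (p / 2 * ln (U z ^ 2 + V z ^ 2))). set (th := atan (V z / U z)).
  assert (HE : 0 < E) by apply exp_pos.
  assert (Hth : - (PI / 2) < th < PI / 2) by (pose proof (atan_bound (V z / U z)); unfold th; lra).
  pose proof (cos_pow_inequality p th Hp Hth) as H.
  apply Rmult_le_compat_l with (r := E) in H; [|lra]. lra.
Qed.

Lemma max_of_harmonics_with_conjugate p D U V :
  open D -> (forall z, D z -> 0 < U z) -> harmonic D U -> harmonic D V -> cauchy_riemann D U V ->
  max_of_harmonics D (mod_pow p (with_conjugate U V)).
Proof.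
  intros oD HU hU hV CR z Dz.
  (* The rotation angle is the argument of [F(z)^p], so the real part equals the modulus at [z]. *)
  exists (fun w => re_pow p (p * atan (V z / U z)) (U w) (V w)). split; [|split].
  - now apply harmonic_re_pow.
  - intros w Dw. rewrite mod_pow_with_conjugate by auto. unfold re_pow.
    rewrite <- (Rmult_1_r (exp _)) at 2. apply Rmult_le_compat_l; [apply Rlt_le, exp_pos|apply COS_bound].
  - rewrite mod_pow_with_conjugate by auto. unfold re_pow. rewrite Rminus_diag, cos_0. ring.
Qed.

Lemma max_of_harmonics_complexify p D U :
  1 < p -> open D -> (forall z, D z -> 0 < U z) -> harmonic D U ->
  max_of_harmonics D (mod_pow p (complexify U)).
Proof.
  intros Hp oD HU hU z Dz.
  exists (fun w => p * Rpower (U z) (p - 1) * U w +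
    1 * ((Rpower (U z) p - p * Rpower (U z) (p - 1) * U z) + 0 * Re w + 0 * Im w)).
  split; [|split].
  - apply harmonic_lin; [exact oD|exact hU|now apply harmonic_affine].
  - intros w Dw. rewrite mod_pow_complexify by auto.
    pose proof (Rpower_tangent p (U z) (U w) Hp (HU z Dz) (HU w Dw)). lra.
  - rewrite mod_pow_complexify by auto. ring.
Qed.

Lemma least_harmonic_majorant_spec D u : (exists h, is_least_harmonic_majorant D u h) ->
  is_least_harmonic_majorant D u (least_harmonic_majorant D u).
Proof. apply epsilon_spec. Qed.

Lemma harmonicC_complexify D U : harmonicC D (complexify U) -> harmonic D U.
Proof. intros [H _]. exact H. Qed.

Lemma admissible_majorant_with_conjugate p D z0 U V h : 1 < p < 2 -> admissible p D z0 U V ->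
  harmonic_majorant D (mod_pow p (complexify U)) h ->
  harmonic_majorant D (mod_pow p (with_conjugate U V))
    (fun z => Rpower (sec (PI / (2 * p))) p * h z + - tan (PI / (2 * p)) * re_pow p 0 (U z) (V z)).
Proof.
  intros Hp ((oD & _) & _ & [hU _] & HU & (hV & aF) & _) (hh & uh).
  apply harmonicC_complexify in hU. apply analytic_cauchy_riemann in aF.
  split.
  - apply harmonic_lin; [exact oD|exact hh|now apply harmonic_re_pow].
  - intros z Dz. pose proof (mod_pow_with_conjugate_le p U V z Hp (HU z Dz)).
    assert (0 < Rpower (sec (PI / (2 * p))) p) by apply exp_pos.
    pose proof (Rmult_le_compat_l _ _ _ (Rlt_le _ _ H0) (uh z Dz)). lra.
Qed.

Lemma admissible_least_complexify p D z0 U V : 1 < p < 2 -> admissible p D z0 U V ->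
  is_least_harmonic_majorant D (mod_pow p (complexify U)) (least_harmonic_majorant D (mod_pow p (complexify U))).
Proof.
  intros Hp ((oD & _) & _ & [hU [h Hh]] & HU & _).
  apply least_harmonic_majorant_spec, least_harmonic_majorant_exists with h; trivial.
  apply max_of_harmonics_complexify; trivial; [lra|exact (harmonicC_complexify D U hU)].
Qed.

Lemma admissible_least_with_conjugate p D z0 U V : 1 < p < 2 -> admissible p D z0 U V ->
  is_least_harmonic_majorant D (mod_pow p (with_conjugate U V))
    (least_harmonic_majorant D (mod_pow p (with_conjugate U V))).
Proof.
  intros Hp HA. pose proof HA as ((oD & _) & _ & [hU [h Hh]] & HU & (hV & aF) & _).
  apply harmonicC_complexify in hU. apply analytic_cauchy_riemann in aF.
  eapply least_harmonic_majorant_spec, least_harmonic_majorant_exists; trivial.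
  - now apply max_of_harmonics_with_conjugate.
  - apply admissible_majorant_with_conjugate with (1 := Hp) (2 := HA) (3 := Hh).
Qed.

Lemma sec_theta_pos p : 1 < p < 2 -> 0 < cos (PI / (2 * p)) /\ 0 < tan (PI / (2 * p)).
Proof.
  intros Hp. destruct (theta_bounds p Hp). pose proof PI_RGT_0.
  split; [apply cos_gt_0; lra|apply tan_gt_0; lra].
Qed.

Lemma rpow_root_scale p s x : 0 < p -> 0 < s -> 0 < x ->
  rpow (Rpower s p * x) (1 / p) = s * rpow x (1 / p).
Proof.
  intros Hp Hs Hx. assert (0 < Rpower s p) by apply exp_pos.
  rewrite !rpow_pos_eq by (trivial; now apply Rmult_lt_0_compat).
  rewrite <- Rpower_mult_distr by trivial. rewrite Rpower_mult.
  replace (p * (1 / p)) with 1 by (field; lra). now rewrite Rpower_1.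
Qed.

Lemma conjugate_norm_bound p D z0 U V : 1 < p < 2 -> admissible p D z0 U V ->
  LH p D (with_conjugate U V) /\
  Lumer_norm p D z0 (with_conjugate U V) <= sec (PI / (2 * p)) * Lumer_norm p D z0 (complexify U).
Proof.
  intros Hp HA.
  destruct (admissible_least_complexify p D z0 U V Hp HA) as [HmU _].
  destruct (admissible_least_with_conjugate p D z0 U V Hp HA) as [HmF HlF].
  pose proof (admissible_majorant_with_conjugate p D z0 U V _ Hp HA HmU) as HM.
  pose proof HA as ((oD & _) & Dz0 & [hU _] & HU & (hV & aF) & V0).
  apply harmonicC_complexify in hU.
  split.
  - split; [split|exact aF].
    + split.
      * apply harmonic_ext with U; trivial. intros z _. now rewrite with_conjugate_eq.
      * apply harmonic_ext with V; trivial. intros z _. now rewrite with_conjugate_eq.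
    + eexists; exact HmF.
  - unfold Lumer_norm.
    pose proof (HlF _ HM z0 Dz0) as Hle. cbn beta in Hle. rewrite V0 in Hle.
    destruct (sec_theta_pos p Hp) as [Hc Ht].
    assert (Hre : 0 < re_pow p 0 (U z0) 0).
    { unfold re_pow. replace (0 / U z0) with 0 by (unfold Rdiv; ring). rewrite atan_0.
      replace (p * 0 - 0) with 0 by ring. rewrite cos_0, Rmult_1_r. apply exp_pos. }
    assert (HUpos : 0 < least_harmonic_majorant D (mod_pow p (complexify U)) z0).
    { apply Rlt_le_trans with (2 := proj2 HmU z0 Dz0). rewrite mod_pow_complexify by auto. apply exp_pos. }
    rewrite <- rpow_root_scale; [|lra|now apply Rinv_0_lt_compat|exact HUpos].
    apply rpow_le; [apply Rdiv_lt_0_compat; lra|].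
    assert (0 < tan (PI / (2 * p)) * re_pow p 0 (U z0) 0) by now apply Rmult_lt_0_compat. lra.
Qed.

(** * Sharpness: strips *)

Definition segment (z w : C) (t : R) : C := (Re z + t * (Re w - Re z), Im z + t * (Im w - Im z)).

Lemma continuous_segment z w t : continuous (segment z w) t.
Proof.
  apply (continuous_pair (U := R_UniformSpace) (V := R_UniformSpace)
    (fun t => Re z + t * (Re w - Re z)) (fun t => Im z + t * (Im w - Im z)));
  apply (ex_derive_continuous (V := R_NormedModule)); auto_derive; trivial.
Qed.

(** Let [tau] be the supremum of the parameters whose point on the segment lies in [A]. If the point
    at [tau] is in [A], then [tau = 1] and [w] is common to both sets; if it is in [B], points of
    [A] with parameters close below or at [tau] are also in [B]. *)
Lemma convex_connected (D : C -> Prop) :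
  (forall z w t, D z -> D w -> 0 <= t <= 1 -> D (segment z w t)) -> Defs.connected D.
Proof.
  intros Hconv A B oA oB HAB [z [Dz Az]] [w [Dw Bw]].
  assert (S0 : segment z w 0 = z) by (unfold segment; rewrite (C_eta z) at 5; f_equal; ring).
  assert (S1 : segment z w 1 = w) by (unfold segment; rewrite (C_eta w) at 3; f_equal; ring).
  destruct (completeness (fun t => 0 <= t <= 1 /\ A (segment z w t))) as [tau [Hub Hlub]].
  { exists 1. intros t [Ht _]. lra. }
  { exists 0. split; [lra|]. now rewrite S0. }
  assert (T0 : 0 <= tau) by (apply Hub; split; [lra|now rewrite S0]).
  assert (T1 : tau <= 1) by (apply Hlub; intros t [Ht _]; lra).
  assert (Dt : D (segment z w tau)) by (apply Hconv; trivial; lra).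
  destruct (HAB _ Dt) as [At|Bt].
  - destruct (Req_dec tau 1) as [E|Hne].
    + exists w. rewrite E, S1 in At. auto.
    + destruct (continuous_segment z w tau A (oA _ At)) as [d Hd].
      pose proof (cond_pos d) as Hd0.
      set (t := tau + Rmin (d / 2) (1 - tau)).
      assert (Hm1 : Rmin (d / 2) (1 - tau) <= d / 2) by apply Rmin_l.
      assert (Hm2 : Rmin (d / 2) (1 - tau) <= 1 - tau) by apply Rmin_r.
      assert (Hm3 : 0 < Rmin (d / 2) (1 - tau)) by (apply Rmin_case; lra).
      assert (t <= tau); [|unfold t in *; lra].
      apply Hub. split; [unfold t; lra|]. apply Hd.
      change (Rabs (t - tau) < d). apply Rabs_def1; unfold t; lra.
  - destruct (continuous_segment z w tau B (oB _ Bt)) as [d Hd].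
    pose proof (cond_pos d) as Hd0.
    apply NNPP. intros Hno.
    assert (tau <= tau - d / 2); [|lra].
    apply Hlub. intros t [Ht At]. apply Rnot_lt_le. intros Hlt. apply Hno.
    exists (segment z w t). split; [now apply Hconv|split; [exact At|]].
    apply Hd. assert (t <= tau) by now apply Hub.
    change (Rabs (t - tau) < d). apply Rabs_def1; lra.
Qed.

(** The Cauchy-Riemann equations make the two real differentials together equal to multiplication by
    [l = U_x + i V_x]. The remainder is [p + i q] with [p], [q] the real remainders, each allowed
    [eps / 2]. *)
Lemma C1_cauchy_riemann_analytic (D : C -> Prop) (U V : C -> R) :
  open D -> C1_on D U -> C1_on D V -> cauchy_riemann D U V -> analytic D (with_conjugate U V).
Proof.
  intros oD HU HV CR z Dz. destruct (CR z Dz) as [C1 C2].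
  assert (Hdiff : forall u, C1_on D u ->
    differentiable_pt_lim (fun a b => u (a, b)) (Re z) (Im z) (dx u z) (dy u z)).
  { intros u Hu. apply filterdiff_differentiable_pt_lim.
    rewrite <- C_eta. exact (C1_on_filterdiff D u z oD Hu Dz). }
  pose proof (Hdiff U HU) as dU. pose proof (Hdiff V HV) as dV.
  set (l := (dx U z, dx V z) : C).
  exists l. split; [apply is_linear_scal_l|].
  intros x Hx. assert (Exz : z = x) by exact (is_filter_lim_locally_unique (K := C_AbsRing) (V := AbsRing_NormedModule C_AbsRing) z x Hx).
  subst x. intros eps. pose proof (cond_pos eps) as Heps.
  assert (He2 : 0 < eps / 2) by lra.
  destruct (dU (mkposreal _ He2)) as [d1 Hd1]. destruct (dV (mkposreal _ He2)) as [d2 Hd2].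
  assert (Hd : 0 < Rmin d1 d2) by (apply Rmin_case; apply cond_pos).
  exists (mkposreal _ Hd). intros w Hw.
  change (Cmod (w - z)%C < Rmin d1 d2) in Hw.
  change (Cmod (with_conjugate U V w - with_conjugate U V z - (w - z) * l)%C <= eps * Cmod (w - z)%C).
  pose proof (Rmin_l d1 d2). pose proof (Rmin_r d1 d2).
  pose proof (Rabs_Re_le (w - z)%C) as Rx. pose proof (Rabs_Im_le (w - z)%C) as Ry.
  change (Re (w - z)%C) with (Re w - Re z) in Rx. change (Im (w - z)%C) with (Im w - Im z) in Ry.
  assert (Rm : Rmax (Rabs (Re w - Re z)) (Rabs (Im w - Im z)) <= Cmod (w - z)) by now apply Rmax_lub.
  specialize (Hd1 (Re w) (Im w) ltac:(lra) ltac:(lra)). specialize (Hd2 (Re w) (Im w) ltac:(lra) ltac:(lra)).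
  rewrite <- !C_eta in Hd1, Hd2. cbn [pos] in Hd1, Hd2.
  set (p := U w - U z - (dx U z * (Re w - Re z) + dy U z * (Im w - Im z))) in *.
  set (q := V w - V z - (dx V z * (Re w - Re z) + dy V z * (Im w - Im z))) in *.
  replace (with_conjugate U V w - with_conjugate U V z - (w - z) * l)%C with (RtoC p + Ci * RtoC q)%C.
  2: { rewrite !with_conjugate_eq. unfold p, q, l. rewrite C2, <- C1.
       unfold Cplus, Cminus, Cmult, Copp, Cplus, Ci, RtoC, Re, Im. cbn. f_equal; ring. }
  apply Rle_trans with (1 := Cmod_triangle _ _). rewrite Cmod_mult, Cmod_Ci, !Cmod_R, Rmult_1_l.
  assert (eps / 2 * Rmax (Rabs (Re w - Re z)) (Rabs (Im w - Im z)) <= eps / 2 * Cmod (w - z))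
    by (apply Rmult_le_compat_l; lra).
  lra.
Qed.

(* [Re (e^(-i a) e^(q z))] *)
Definition expcos (q a : R) (z : C) : R := exp (q * Re z) * cos (q * Im z - a).

Lemma has_partials_expcos q a z :
  has_partials (expcos q a) (fun w => q * expcos q a w) (fun w => q * expcos q (a - PI / 2) w) z.
Proof.
  unfold has_partials, expcos. cbn [Re Im fst snd]. split; auto_derive; trivial.
  - unfold Re, Im. ring.
  - replace (q * Im z - (a - PI / 2)) with ((q * Im z - a) + PI / 2) by ring.
    rewrite cos_plus, cos_PI2, sin_PI2. unfold Re, Im, Rminus. ring.
Qed.

Lemma continuous_expcos q a z : continuous (expcos q a) z.
Proof.
  apply continuous_Rmult.
  - apply (continuous_derivable (fun x => exp (q * x)) Re); [auto_derive; trivial|apply continuous_Re].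
  - apply (continuous_derivable (fun x => cos (q * x - a)) Im); [auto_derive; trivial|apply continuous_Im].
Qed.

Lemma harmonic_expcos D q a : open D -> harmonic D (expcos q a).
Proof.
  intros oD.
  assert (c : forall k q a z, continuous (fun w => k * (q * expcos q a w)) z).
  { intros k q' a' z. apply continuous_Rmult; [apply continuous_const|].
    apply continuous_Rmult; [apply continuous_const|apply continuous_expcos]. }
  assert (c1 : forall q a z, continuous (fun w => q * expcos q a w) z).
  { intros q' a' z. apply continuous_Rmult; [apply continuous_const|apply continuous_expcos]. }
  assert (P : forall a z, has_partials (fun w => q * expcos q a w)
     (fun w => q * (q * expcos q a w)) (fun w => q * (q * expcos q (a - PI / 2) w)) z).
  { intros a' z. pose proof (has_partials_expcos q a' z) as H.
    refine (has_partials_ext_loc _ _ _ _ _ _ z _ _ _ (has_partials_lin q 0 _ _ _ _ _ _ z H H)).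
    - apply filter_forall. intros w. ring.
    - ring.
    - ring. }
  apply harmonic_intro with (ux := fun w => q * expcos q a w) (uy := fun w => q * expcos q (a - PI / 2) w)
    (uxx := fun w => q * (q * expcos q a w)) (uxy := fun w => q * (q * expcos q (a - PI / 2) w))
    (uyx := fun w => q * (q * expcos q (a - PI / 2) w)) (uyy := fun w => q * (q * expcos q (a - PI / 2 - PI / 2) w));
    auto.
  - intros z _. apply has_partials_expcos.
  - intros z _. unfold expcos.
    replace (q * Im z - (a - PI / 2 - PI / 2)) with (q * Im z - a + PI) by field. rewrite neg_cos. ring.
Qed.

(** * The exponential on a strip *)

Definition strip (phi : R) (z : C) : Prop := - phi < Im z < phi.

Lemma open_strip phi : open (strip phi).
Proof.
  apply open_and; intros z Hz; [apply locally_gt|apply locally_lt]; trivial; apply continuous_Im.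
Qed.

Lemma domain_strip phi : 0 < phi -> Defs.domain (strip phi).
Proof.
  intros Hphi. split; [apply open_strip|split].
  - apply convex_connected. intros z w t Hz Hw Ht. unfold strip, segment in *. cbn [Im fst snd] in *.
    change (snd z) with (Im z). change (snd w) with (Im w).
    assert (Hc : forall a b, 0 < a -> 0 < b -> 0 < a + t * (b - a)).
    { intros a b Ha Hb. destruct (Rle_dec a b).
      - assert (0 <= t * (b - a)) by (apply Rmult_le_pos; lra). lra.
      - assert (0 <= (1 - t) * (a - b)) by (apply Rmult_le_pos; lra). lra. }
    pose proof (Hc (Im z + phi) (Im w + phi) ltac:(lra) ltac:(lra)).
    pose proof (Hc (phi - Im z) (phi - Im w) ltac:(lra) ltac:(lra)). lra.
  - exists (0, 0). unfold strip. cbn. lra.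
Qed.

(** The pair is [e^z], since [cos(y - PI / 2) = sin y]. *)
Lemma strip_harmonic_conjugate phi : harmonic_conjugate (strip phi) (expcos 1 0) (expcos 1 (PI / 2)).
Proof.
  pose proof (open_strip phi) as oS.
  split; [now apply harmonic_expcos|].
  destruct (harmonic_expcos (strip phi) 1 0 oS) as [[HU _] _].
  destruct (harmonic_expcos (strip phi) 1 (PI / 2) oS) as [[HV _] _].
  apply C1_cauchy_riemann_analytic; trivial.
  intros z _.
  rewrite (has_partials_dx _ _ _ _ (has_partials_expcos 1 0 z)), (has_partials_dy _ _ _ _ (has_partials_expcos 1 0 z)).
  rewrite (has_partials_dx _ _ _ _ (has_partials_expcos 1 (PI / 2) z)), (has_partials_dy _ _ _ _ (has_partials_expcos 1 (PI / 2) z)).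
  rewrite Rminus_diag. split; [reflexivity|].
  unfold expcos. replace (1 * Im z - (0 - PI / 2)) with (1 * Im z - PI / 2 + PI) by field. rewrite neg_cos. ring.
Qed.

Lemma expcos_1_0_pos phi z : phi < PI / 2 -> strip phi z -> 0 < expcos 1 0 z.
Proof.
  intros Hphi [H1 H2]. apply Rmult_lt_0_compat; [apply exp_pos|]. apply cos_gt_0; lra.
Qed.

Lemma mod_pow_strip_conjugate p z :
  mod_pow p (with_conjugate (expcos 1 0) (expcos 1 (PI / 2))) z = exp (p * Re z).
Proof.
  unfold mod_pow. rewrite with_conjugate_eq.
  replace (Cmod (expcos 1 0 z, expcos 1 (PI / 2) z)) with (exp (Re z)).
  - rewrite rpow_pos_eq by apply exp_pos. unfold Rpower. now rewrite ln_exp.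
  - symmetry. unfold Cmod, expcos. cbn [fst snd].
    replace (1 * Im z - PI / 2) with (- (PI / 2 - Im z)) by ring. rewrite cos_neg, cos_shift.
    rewrite Rmult_1_l, Rminus_0_r, Rmult_1_l. apply sqrt_lem_1.
    + pose proof (pow2_ge_0 (exp (Re z) * cos (Im z))). pose proof (pow2_ge_0 (exp (Re z) * sin (Im z))). lra.
    + apply Rlt_le, exp_pos.
    + pose proof (sin2_cos2 (Im z)) as E. unfold Rsqr in E.
      replace (exp (Re z) * exp (Re z)) with (exp (Re z) * exp (Re z) * (sin (Im z) * sin (Im z) + cos (Im z) * cos (Im z)))
        by (rewrite E; ring). ring.
Qed.

Lemma harmonic_translate D (h : C -> R) t : open D -> (forall z, D z -> D (Re z + t, Im z)) ->
  harmonic D h -> harmonic D (fun z => h (Re z + t, Im z)).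
Proof.
  intros oD HD [(H1 & H2 & H3) L].
  set (tr := fun z : C => (Re z + t, Im z) : C).
  assert (ctr : forall z, continuous tr z).
  { intros z. apply (continuous_pair (U := R_UniformSpace) (V := R_UniformSpace) (fun z : C => Re z + t) Im).
    - apply continuous_Rplus; [apply continuous_Re|apply continuous_const].
    - apply continuous_Im. }
  assert (P : forall u, C1_on D u -> forall z, D z ->
     has_partials (fun w => u (tr w)) (fun w => dx u (tr w)) (fun w => dy u (tr w)) z).
  { intros u Hu z Dz. destruct (C1_on_partials D u (tr z) Hu (HD z Dz)) as [P1 P2]. split.
    - replace (dx u (tr z)) with (scal 1 (dx u (tr z))) by apply Rmult_1_l.
      apply (is_derive_comp (fun s => u (s, Im z)) (fun s => s + t)); [exact P1|].
      auto_derive; trivial.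
    - exact P2. }
  assert (c : forall u : C -> R, (forall z, D z -> continuous u z) -> forall z, D z -> continuous (fun w => u (tr w)) z).
  { intros u cu z Dz. apply (continuous_comp tr u); [apply ctr|]. now apply cu, HD. }
  apply harmonic_intro with (ux := fun w => dx h (tr w)) (uy := fun w => dy h (tr w))
   (uxx := fun w => dx (dx h) (tr w)) (uxy := fun w => dy (dx h) (tr w))
   (uyx := fun w => dx (dy h) (tr w)) (uyy := fun w => dy (dy h) (tr w)); trivial.
  1: exact (P h H1). 1: exact (P _ H2). 1: exact (P _ H3).
  1, 3, 5: apply c; intros z Dz; apply C1_on_continuous_dx with D; assumption.
  1, 2, 3: apply c; intros z Dz; apply C1_on_continuous_dy with D; assumption.
  intros z Dz. exact (L (tr z) (HD z Dz)).
Qed.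

Lemma strip_least_translation p phi h :
  is_least_harmonic_majorant (strip phi) (fun z => exp (p * Re z)) h ->
  forall x y, - phi < y < phi -> h (x, y) = exp (p * x) * h (0, y).
Proof.
  intros [[hh uh] Hl].
  assert (Hle : forall t z, strip phi z -> h z <= exp (- p * t) * h (Re z + t, Im z)).
  { intros t z Hz.
    assert (HM : harmonic_majorant (strip phi) (fun z => exp (p * Re z))
       (fun z => exp (- p * t) * h (Re z + t, Im z) + 0 * h z)).
    { split.
      - apply (harmonic_lin (strip phi) (exp (- p * t)) 0 (fun z => h (Re z + t, Im z)) h); trivial.
        + apply open_strip.
        + apply harmonic_translate; trivial. apply open_strip.
      - intros w Hw. pose proof (uh (Re w + t, Im w) Hw) as Hu. cbn [Re fst] in Hu.
        apply Rmult_le_compat_l with (r := exp (- p * t)) in Hu; [|apply Rlt_le, exp_pos].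
        rewrite <- exp_plus in Hu.
        cbn beta. unfold Re, Im in *.
        replace (- p * t + p * (fst w + t)) with (p * fst w) in Hu by ring. lra. }
    pose proof (Hl _ HM z Hz) as H. cbn beta in H. lra. }
  intros x y Hy.
  (* Translating by [- x] and by [x] gives the two opposite inequalities. *)
  pose proof (Hle (- x) (x, y) Hy) as A. pose proof (Hle x (0, y) Hy) as B. cbn [Re Im fst snd] in A, B.
  replace (x + - x) with 0 in A by ring. rewrite Rplus_0_l in B.
  replace (- p * - x) with (p * x) in A by ring.
  apply Rle_antisym; [exact A|].
  apply Rmult_le_compat_l with (r := exp (p * x)) in B; [|apply Rlt_le, exp_pos].
  rewrite <- Rmult_assoc, <- exp_plus in B. replace (p * x + - p * x) with 0 in B by ring.
  rewrite exp_0 in B. lra.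
Qed.

Lemma constant_on_interval (g : R -> R) (phi y : R) :
  (forall t, - phi < t < phi -> is_derive g t 0) -> - phi < y < phi -> g y = g 0.
Proof.
  intros H Hy. symmetry. apply zero_derivative_eq. intros t Ht. apply H.
  revert Ht. apply Rmin_case; apply Rmax_case; lra.
Qed.

(** Rotating the vector [(p f, f')] by the angle [p t] yields two constants of motion; solving them
    for [f] gives the formula. *)
Lemma harmonic_oscillator (f f' : R -> R) p phi : 0 < p ->
  (forall t, - phi < t < phi -> is_derive f t (f' t)) ->
  (forall t, - phi < t < phi -> is_derive f' t (- p ^ 2 * f t)) ->
  forall y, - phi < y < phi -> f y = f 0 * cos (p * y) + f' 0 / p * sin (p * y).
Proof.
  intros Hp Hf Hf' y Hy.
  assert (D1 : forall a b : R -> R, forall t a' b', is_derive a t a' -> is_derive b t b' ->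
     is_derive (fun t => a t * b t) t (a' * b t + a t * b')).
  { intros a b t a' b' Ha Hb. apply (is_derive_mult a b); trivial. intros; apply Rmult_comm. }
  assert (dc : forall t, is_derive (fun t => cos (p * t)) t (- p * sin (p * t))).
  { intros t. auto_derive; trivial. ring. }
  assert (ds : forall t, is_derive (fun t => sin (p * t)) t (p * cos (p * t))).
  { intros t. auto_derive; trivial. ring. }
  assert (EA := constant_on_interval (fun t => p * (f t * cos (p * t)) - f' t * sin (p * t)) phi y).
  assert (EB := constant_on_interval (fun t => p * (f t * sin (p * t)) + f' t * cos (p * t)) phi y).
  cbn beta in EA, EB. rewrite Rmult_0_r, cos_0, sin_0 in EA, EB.
  specialize (EA ltac:(intros t Ht; evar_last;
    [apply (is_derive_minus (fun t => p * (f t * cos (p * t))) (fun t => f' t * sin (p * t)));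
      [apply is_derive_scal; apply D1; [now apply Hf|apply dc]|apply D1; [now apply Hf'|apply ds]]
    |unfold minus, plus, opp, scal; cbn; unfold mult; cbn; ring]) Hy).
  specialize (EB ltac:(intros t Ht; evar_last;
    [apply (is_derive_plus (fun t => p * (f t * sin (p * t))) (fun t => f' t * cos (p * t)));
      [apply is_derive_scal; apply D1; [now apply Hf|apply ds]|apply D1; [now apply Hf'|apply dc]]
    |unfold minus, plus, opp, scal; cbn; unfold mult; cbn; ring]) Hy).
  apply Rmult_eq_reg_l with p; [|lra].
  pose proof (sin2_cos2 (p * y)) as E. unfold Rsqr in E.
  transitivity (p * f y * (sin (p * y) * sin (p * y) + cos (p * y) * cos (p * y))); [rewrite E; ring|].
  replace (p * (f 0 * cos (p * y) + f' 0 / p * sin (p * y))) with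
    ((p * (f 0 * 1) - f' 0 * 0) * cos (p * y) + (p * (f 0 * 0) + f' 0 * 1) * sin (p * y)) by (field; lra).
  rewrite <- EA, <- EB. ring.
Qed.

Lemma strip_least_lower_bound p phi h : 0 < p ->
  is_least_harmonic_majorant (strip phi) (fun z => exp (p * Re z)) h ->
  forall y, - phi < y < phi -> 1 <= h (0, 0) * cos (p * y).
Proof.
  intros Hp Hh. pose proof (strip_least_translation p phi h Hh) as Htr.
  destruct Hh as [[[(H1 & H2 & H3) L] uh] _].
  assert (Ex : forall a y, is_derive (fun x => exp (p * x) * h (0, y)) a (p * (exp (p * a) * h (0, y)))).
  { intros a y. auto_derive; trivial. ring. }
  assert (Edx : forall x y, - phi < y < phi -> dx h (x, y) = p * (exp (p * x) * h (0, y))).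
  { intros x y Hy. apply is_derive_unique. apply is_derive_ext with (2 := Ex x y).
    intros s. cbn [Im snd]. symmetry. now apply Htr. }
  assert (Edxx : forall y, - phi < y < phi -> dx (dx h) (0, y) = p ^ 2 * h (0, y)).
  { intros y Hy. apply is_derive_unique. cbn [Re Im fst snd].
    apply is_derive_ext with (fun x => p * (exp (p * x) * h (0, y))).
    - intros s. symmetry. now apply Edx.
    - auto_derive; trivial. rewrite Rmult_0_r, exp_0. ring. }
  assert (Hosc := harmonic_oscillator (fun y => h (0, y)) (fun y => dy h (0, y)) p phi Hp).
  assert (Hf : forall y, - phi < y < phi ->
    h (0, y) = h (0, 0) * cos (p * y) + dy h (0, 0) / p * sin (p * y)).
  { apply Hosc.
    - intros t Ht. exact (proj2 (C1_on_partials (strip phi) h (0, t) H1 Ht)).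
    - intros t Ht. replace (- p ^ 2 * h (0, t)) with (dy (dy h) (0, t)).
      + exact (proj2 (C1_on_partials (strip phi) (dy h) (0, t) H3 Ht)).
      + specialize (L (0, t) Ht). rewrite (Edxx t Ht) in L. lra. }
  intros y Hy.
  (* Adding the bounds at [y] and [- y] removes the sine term, whose coefficient is unknown. *)
  pose proof (uh (0, y) Hy) as A. pose proof (uh (0, - y) ltac:(unfold strip; cbn; lra)) as B.
  cbn [Re fst] in A, B. rewrite Rmult_0_r, exp_0 in A, B.
  rewrite Hf in A by lra. rewrite Hf in B by lra.
  replace (p * - y) with (- (p * y)) in B by ring. rewrite cos_neg, sin_neg in B. lra.
Qed.

(** The majorant is a multiple of [Re e^(p z)], scaled to agree with [U^p] on the edges
    [|Im z| = phi]. The bound on [phi] keeps [cos(p phi)] positive. *)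
Lemma strip_complexify_majorant p phi : 1 < p < 2 -> 0 < phi < PI / (2 * p) ->
  harmonic_majorant (strip phi) (mod_pow p (complexify (expcos 1 0)))
    (fun z => Rpower (cos phi) p / cos (p * phi) * expcos p 0 z + 0 * expcos p 0 z).
Proof.
  intros Hp Hphi. destruct (theta_bounds p Hp) as [_ Hth]. pose proof PI_RGT_0.
  assert (Hpphi : p * phi < PI / 2).
  { replace (PI / 2) with (p * (PI / (2 * p))) by (field; lra). apply Rmult_lt_compat_l; lra. }
  assert (0 < p * phi) by (apply Rmult_lt_0_compat; lra).
  assert (cp : 0 < cos (p * phi)) by (apply cos_gt_0; lra).
  split.
  - apply harmonic_lin; [apply open_strip| |]; apply harmonic_expcos, open_strip.
  - intros z Hz. assert (Hpos := expcos_1_0_pos phi z ltac:(lra) Hz).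
    rewrite mod_pow_complexify by exact Hpos.
    destruct Hz as [Hz1 Hz2].
    unfold expcos. rewrite !Rminus_0_r, !Rmult_1_l.
    rewrite <- Rpower_mult_distr; [|apply exp_pos|apply cos_gt_0; lra].
    replace (Rpower (exp (Re z)) p) with (exp (p * Re z)) by (unfold Rpower; now rewrite ln_exp).
    assert (Ha : Rabs (Im z) <= phi) by (apply Rabs_le; lra).
    pose proof (cos_quotient_decreasing p (Rabs (Im z)) phi Hp (conj (Rabs_pos _) Ha) ltac:(lra)) as Hd.
    assert (E1 : cos (p * Rabs (Im z)) = cos (p * Im z)).
    { unfold Rabs. destruct Rcase_abs; [|reflexivity]. rewrite <- Ropp_mult_distr_r. apply cos_neg. }
    assert (E2 : cos (Rabs (Im z)) = cos (Im z)).
    { unfold Rabs. destruct Rcase_abs; [|reflexivity]. apply cos_neg. }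
    rewrite E1, E2 in Hd.
    replace (Rpower (cos phi) p / cos (p * phi) * (exp (p * Re z) * cos (p * Im z)) + 0 * (exp (p * Re z) * cos (p * Im z)))
      with (exp (p * Re z) * (cos (p * Im z) * Rpower (cos phi) p / cos (p * phi))) by (field; lra).
    apply Rmult_le_compat_l; [apply Rlt_le, exp_pos|].
    apply Rle_div_r; [exact cp|]. lra.
Qed.

Lemma strip_admissible p phi : 1 < p < 2 -> 0 < phi < PI / (2 * p) ->
  admissible p (strip phi) (RtoC 0) (expcos 1 0) (expcos 1 (PI / 2)).
Proof.
  intros Hp Hphi. destruct (theta_bounds p Hp) as [_ Hth].
  split; [apply domain_strip; lra|]. split; [unfold strip; cbn; lra|]. split; [|split; [|split]].
  - split.
    + split.
      * exact (harmonic_expcos (strip phi) 1 0 (open_strip phi)).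
      * apply harmonic_ext with (fun z => 0 + 0 * Re z + 0 * Im z); [apply open_strip| |].
        -- intros z _. cbn. ring.
        -- apply harmonic_affine, open_strip.
    + eexists. now apply strip_complexify_majorant.
  - intros z Hz. apply expcos_1_0_pos with phi; [lra|exact Hz].
  - apply strip_harmonic_conjugate.
  - unfold expcos. cbn. replace (1 * 0 - PI / 2) with (- (PI / 2)) by ring. rewrite cos_neg, cos_PI2. ring.
Qed.

Lemma strip_conjugate_lower p phi : 1 < p < 2 -> 0 < phi < PI / (2 * p) ->
  / cos (p * phi) <= least_harmonic_majorant (strip phi)
    (mod_pow p (with_conjugate (expcos 1 0) (expcos 1 (PI / 2)))) (RtoC 0).
Proof.
  intros Hp Hphi. pose proof PI_RGT_0.
  assert (Hpphi : p * phi < PI / 2).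
  { replace (PI / 2) with (p * (PI / (2 * p))) by (field; lra). apply Rmult_lt_compat_l; lra. }
  assert (0 < p * phi) by (apply Rmult_lt_0_compat; lra).
  assert (cp : 0 < cos (p * phi)) by (apply cos_gt_0; lra).
  pose proof (admissible_least_with_conjugate p _ _ _ _ Hp (strip_admissible p phi Hp Hphi)) as HL.
  set (h := least_harmonic_majorant _ _) in *.
  replace (mod_pow p (with_conjugate (expcos 1 0) (expcos 1 (PI / 2)))) with (fun z => exp (p * Re z)) in HL
    by (apply functional_extensionality; intros z; now rewrite mod_pow_strip_conjugate).
  pose proof (strip_least_lower_bound p phi h ltac:(lra) HL) as Hlow. change (RtoC 0) with (0, 0).
  (* The bound is known for [y < phi] only; continuity of the cosine carries it to the edge, where
     [h] itself is not controlled. *)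
  assert (Hlim : 1 <= h (0, 0) * cos (p * phi)).
  { apply Rnot_lt_le. intros Hlt.
    destruct (locally_lt (fun y => h (0, 0) * cos (p * y)) phi 1) as [d Hd].
    - apply (ex_derive_continuous (V := R_NormedModule)). auto_derive. trivial.
    - exact Hlt.
    - pose proof (cond_pos d).
      assert (Hm1 : Rmin d phi <= d) by apply Rmin_l. assert (Hm2 : Rmin d phi <= phi) by apply Rmin_r.
      assert (Hm3 : 0 < Rmin d phi) by (apply Rmin_case; lra).
      specialize (Hlow (phi - Rmin d phi / 2) ltac:(lra)).
      specialize (Hd (phi - Rmin d phi / 2)). cbn beta in Hd.
      assert (h (0, 0) * cos (p * (phi - Rmin d phi / 2)) < 1); [|lra].
      apply Hd. change (Rabs (phi - Rmin d phi / 2 - phi) < d). apply Rabs_def1; lra. }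
  apply Rmult_le_reg_r with (cos (p * phi)); [exact cp|]. rewrite Rinv_l by lra. exact Hlim.
Qed.

Lemma strip_complexify_upper p phi : 1 < p < 2 -> 0 < phi < PI / (2 * p) ->
  0 < least_harmonic_majorant (strip phi) (mod_pow p (complexify (expcos 1 0))) (RtoC 0)
    <= Rpower (cos phi) p * / cos (p * phi).
Proof.
  intros Hp Hphi.
  pose proof (strip_admissible p phi Hp Hphi) as HA.
  destruct (admissible_least_complexify p _ _ _ _ Hp HA) as [[_ Hm] Hl].
  destruct HA as (_ & H0 & _ & Hpos & _).
  split.
  - apply Rlt_le_trans with (2 := Hm _ H0). rewrite mod_pow_complexify by now apply Hpos. apply exp_pos.
  - pose proof (Hl _ (strip_complexify_majorant p phi Hp Hphi) _ H0) as H. cbn beta in H.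
    replace (expcos p 0 (RtoC 0)) with 1 in H.
    + unfold Rdiv in H. lra.
    + unfold expcos. cbn. rewrite Rmult_0_r, Rminus_0_r, cos_0, exp_0. ring.
Qed.

Lemma strip_constant_lower p c phi : 1 < p < 2 -> 0 < phi < PI / (2 * p) ->
  Lumer_norm p (strip phi) (RtoC 0) (with_conjugate (expcos 1 0) (expcos 1 (PI / 2)))
    <= c * Lumer_norm p (strip phi) (RtoC 0) (complexify (expcos 1 0)) ->
  sec phi <= c.
Proof.
  intros Hp Hphi HN. pose proof PI_RGT_0. destruct (theta_bounds p Hp) as [_ Hth].
  assert (Hpphi : p * phi < PI / 2).
  { replace (PI / 2) with (p * (PI / (2 * p))) by (field; lra). apply Rmult_lt_compat_l; lra. }
  assert (0 < p * phi) by (apply Rmult_lt_0_compat; lra).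
  assert (cp : 0 < cos (p * phi)) by (apply cos_gt_0; lra).
  assert (cphi : 0 < cos phi) by (apply cos_gt_0; lra).
  assert (icp : 0 < / cos (p * phi)) by now apply Rinv_0_lt_compat.
  assert (p1 : 0 < 1 / p) by (apply Rdiv_lt_0_compat; lra).
  pose proof (strip_conjugate_lower p phi Hp Hphi) as HF.
  destruct (strip_complexify_upper p phi Hp Hphi) as [HU0 HU].
  unfold Lumer_norm in HN.
  set (HFz := least_harmonic_majorant _ (mod_pow p (with_conjugate _ _)) _) in *.
  set (HUz := least_harmonic_majorant _ (mod_pow p (complexify _)) _) in *.
  (* The common factor of both estimates: the norm of [F] is at least [K], that of [U] at most
     [cos(phi) K]. *)
  set (K := rpow (/ cos (p * phi)) (1 / p)).
  assert (HK : 0 < K) by (unfold K; rewrite rpow_pos_eq by exact icp; apply exp_pos).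
  assert (A : K <= rpow HFz (1 / p)) by now apply rpow_le.
  assert (B : rpow HUz (1 / p) <= cos phi * K).
  { unfold K. rewrite <- rpow_root_scale; [|lra|exact cphi|exact icp]. now apply rpow_le. }
  assert (HNU : 0 < rpow HUz (1 / p)) by (rewrite rpow_pos_eq by exact HU0; apply exp_pos).
  (* The upper bound on the norm of [U] can be multiplied by [c] only once [c] is known to be
     nonnegative. *)
  assert (Hc : 0 < c).
  { apply Rnot_le_lt. intros Hc. assert (0 <= - c * rpow HUz (1 / p)) by (apply Rmult_le_pos; lra). lra. }
  assert (Hfin : K * 1 <= K * (c * cos phi)).
  { assert (c * rpow HUz (1 / p) <= c * (cos phi * K)) by (apply Rmult_le_compat_l; lra). lra. }
  apply Rmult_le_reg_l in Hfin; [|exact HK].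
  unfold sec. apply Rmult_le_reg_r with (cos phi); [exact cphi|]. rewrite Rinv_l by lra. exact Hfin.
Qed.

Theorem theorem6p4 (p : R) (hp : 1 < p < 2) :
  (forall (D : C -> Prop) (z0 : C) (U V : C -> R),
     admissible p D z0 U V ->
     LH p D (with_conjugate U V) /\
     Lumer_norm p D z0 (with_conjugate U V)
       <= sec (PI / (2 * p)) * Lumer_norm p D z0 (complexify U)) /\
  (forall c : R,
     (forall (D : C -> Prop) (z0 : C) (U V : C -> R),
        admissible p D z0 U V ->
        Lumer_norm p D z0 (with_conjugate U V)
          <= c * Lumer_norm p D z0 (complexify U)) ->
     sec (PI / (2 * p)) <= c).
Proof.
  split.
  - intros D z0 U V HA. now apply conjugate_norm_bound.
  - intros c Hc. apply Rnot_lt_le. intros Hlt.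
    destruct (theta_bounds p hp) as [Ht1 Ht2]. pose proof PI_RGT_0.
    destruct (sec_theta_pos p hp) as [Hcos _].
    (* By continuity of [sec], a constant below [sec(th)] is already beaten by [sec(phi)] for some
       [phi < th]; below, [phi = th - m / 2] with [m <= th] keeps [phi] positive. *)
    destruct (locally_gt sec (PI / (2 * p)) c) as [d Hd].
    + apply (ex_derive_continuous (V := R_NormedModule)). unfold sec. auto_derive. lra.
    + exact Hlt.
    + pose proof (cond_pos d).
      set (m := Rmin d (PI / (2 * p))).
      assert (Hm1 : m <= d) by apply Rmin_l. assert (Hm2 : m <= PI / (2 * p)) by apply Rmin_r.
      assert (Hm3 : 0 < m) by (apply Rmin_case; lra).
      assert (Hphi : 0 < PI / (2 * p) - m / 2 < PI / (2 * p)) by lra.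
      assert (Hgt : c < sec (PI / (2 * p) - m / 2)).
      { apply Hd. change (Rabs (PI / (2 * p) - m / 2 - PI / (2 * p)) < d). apply Rabs_def1; lra. }
      pose proof (strip_constant_lower p c _ hp Hphi (Hc _ _ _ _ (strip_admissible p _ hp Hphi))). lra.
Qed.
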